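(* Let $L\ge 3$ be an integer and let $\mathcal{D}_L=[0,L]\times[0,2]$. Then the even domino group $G_{\mathcal{D}_L}^+$ is isomorphic to the group $$G_L^+=\langle S_L \mid [a_m,a_n]=1 \text{ for } (m,n)\in R_L\rangle,$$ where $S_L=\{a_i : i\in\mathbb{Z}_{\ne0},\ |i|\le\lfloor\frac{L-1}{2}\rfloor\}$ is a set of symbols and $R_L=\{(m,n)\in\mathbb{Z}^2 : \max\{|m|,|n|,|m-n|\}<\lfloor\frac{L}{2}\rfloor\}$.
   Context: In the presentation of $G_L^+$, $[x,y]$ denotes the commutator, and $a_0$ is understood as the identity, so that pairs $(m,n)\in R_L$ with $m=0$ or $n=0$ impose no relation. A quadriculated disk $\mathcal{D}\subset\mathbb{R}^2$ is a finite union of closed unit squares with vertices in $\mathbb{Z}^2$ that is homeomorphic to a closed disk. The unit square $[a,a+1]\times[b,b+1]$, $(a,b)\in\mathbb{Z}^2$, is white if $a+b$ is even and black if $a+b$ is odd. Two unit squares are adjacent if they share an edge; a planar domino is a union of two adjacent unit squares. Domino group. A plug is a union $p\subseteq\mathcal{D}$ of unit squares of $\mathcal{D}$ with equally many white and black squares; $\mathbf{p}_\circ=\emptyset$ is the empty plug. Two plugs are disjoint if their interiors are disjoint. The 2-complex $\mathcal{C}_{\mathcal{D}}$ is defined as follows. - Vertices: the plugs. - Edges: for every two distinct disjoint plugs $p_1,p_2$, one edge between $p_1$ and $p_2$ for each planar domino tiling of $\mathcal{D}\smallsetminus\mathrm{int}(p_1\cup p_2)$ (the empty region has exactly one tiling,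 the empty one); also one loop at $\mathbf{p}_\circ$ for each planar domino tiling of $\mathcal{D}$. - 2-cells: (i) for each loop $f$, a disk attached along $f*f$ (so that a projective plane results); (ii) for each two edges joining the same two distinct plugs whose tilings differ by a single planar flip (replacing two parallel dominoes forming a $2\times2$ square by the other two), a disk attached along the resulting bigon; (iii) for each four plugs $p_1,p_2,p_3,p_4$ with $p_2$ disjoint from $p_1$ and from $p_4$, and $p_2=p_3\cup d$ where $d$ is a domino whose two unit squares are not in $p_3$, and for each tiling $f_1^*$ of $\mathcal{D}\smallsetminus\mathrm{int}(p_1\cup p_2)$ and each tiling $f_2^*$ of $\mathcal{D}\smallsetminus\mathrm{int}(p_2\cup p_4)$, a disk attached along the quadrilateral $p_1\to p_2\to p_4\to p_3\to p_1$ with edges $f_1^*$, $f_2^*$, $f_2^*\cup\{d\}$, $f_1^*\cup\{d\}$. The domino group is $G_{\mathcal{D}}=\pi_1(\mathcal{C}_{\mathcal{D}},\mathbf{p}_\circ)$. The even domino group $G_{\mathcal{D}}^+$ is the kernel of the homomorphism $G_{\mathcal{D}}\to\mathbb{Z}/(2)$ sending a closed edge path of length $N$ to $N \bmod 2$. *)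

(* Defs.v *)
From HB Require Import structures.
From Stdlib Require Import Relation_Operators.
From mathcomp Require Import all_boot all_order all_algebra all_fingroup.
From mathcomp Require Import generic_quotient finmap boolp.

Set Implicit Arguments.
Unset Strict Implicit.
Unset Printing Implicit Defensive.

Local Open Scope ring_scope.
Local Open Scope quotient_scope.

(* A set with operations satisfying the group laws only up to [pg_eq]; the
   quotient by [pg_eq] is a group. *)
Record pregroup := Pregroup {
  pg_car :> choiceType;
  pg_eq : pg_car -> pg_car -> Prop;
  pg_one : pg_car;
  pg_mul : pg_car -> pg_car -> pg_car;
  pg_inv : pg_car -> pg_car;
  pg_refl : forall x, pg_eq x x;
  pg_sym : forall x y, pg_eq x y -> pg_eq y x;
  pg_trans : forall x y z, pg_eq x y -> pg_eq y z -> pg_eq x z;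
  pg_mulE : forall x x' y y',
    pg_eq x x' -> pg_eq y y' -> pg_eq (pg_mul x y) (pg_mul x' y');
  pg_mulA : forall x y z,
    pg_eq (pg_mul x (pg_mul y z)) (pg_mul (pg_mul x y) z);
  pg_mul1g : forall x, pg_eq (pg_mul pg_one x) x;
  pg_mulg1 : forall x, pg_eq (pg_mul x pg_one) x;
  pg_mulVg : forall x, pg_eq (pg_mul (pg_inv x) x) pg_one;
  pg_mulgV : forall x, pg_eq (pg_mul x (pg_inv x)) pg_one }.

Section QuotientGroup.
Variable P : pregroup.

Definition pg_rel (x y : P) : bool := `[< pg_eq x y >].

Lemma pg_rel_refl : reflexive pg_rel.
Proof. by move=> x; apply/asboolP/pg_refl. Qed.

Lemma pg_rel_sym : symmetric pg_rel.
Proof. by move=> x y; apply/asboolP/asboolP; apply: pg_sym. Qed.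

Lemma pg_rel_trans : transitive pg_rel.
Proof. by move=> y x z /asboolP xy /asboolP yz; apply/asboolP/(pg_trans xy). Qed.

Canonical pg_equiv := EquivRel pg_rel pg_rel_refl pg_rel_sym pg_rel_trans.

Definition quotient_group := {eq_quot pg_equiv}.
HB.instance Definition _ := Choice.on quotient_group.

Definition qclass (x : P) : quotient_group := \pi_{eq_quot pg_equiv} x.
Definition qrepr (g : quotient_group) : P := repr (g : {eq_quot pg_equiv}).

Lemma qreprK g : qclass (qrepr g) = g.
Proof. exact: (@reprK _ {eq_quot pg_equiv}). Qed.

Lemma qclassP x y : qclass x = qclass y <-> pg_eq x y.
Proof.
split; first by move/eqmodP/asboolP.
by move=> xy; apply/eqmodP/asboolP.
Qed.

Lemma qreprP x : pg_eq (qrepr (qclass x)) x.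
Proof. by apply/qclassP; rewrite qreprK. Qed.

Definition qone : quotient_group := qclass (pg_one P).
Definition qmul (g h : quotient_group) : quotient_group :=
  qclass (pg_mul (qrepr g) (qrepr h)).
Definition qinv (g : quotient_group) : quotient_group :=
  qclass (pg_inv (qrepr g)).

Lemma qmulA : associative qmul.
Proof.
move=> x y z; apply/qclassP.
apply: pg_trans (pg_mulE (pg_refl _) (qreprP _)) _.
apply: pg_trans (pg_mulA _ _ _) _.
by apply: pg_mulE (pg_refl _); apply/pg_sym/qreprP.
Qed.

Lemma qmul1g : left_id qone qmul.
Proof.
move=> x; rewrite -[RHS]qreprK; apply/qclassP.
by apply: pg_trans (pg_mul1g _); apply: pg_mulE (pg_refl _); apply: qreprP.
Qed.

Lemma qmulg1 : right_id qone qmul.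
Proof.
move=> x; rewrite -[RHS]qreprK; apply/qclassP.
by apply: pg_trans (pg_mulg1 _); apply: pg_mulE (pg_refl _) _; apply: qreprP.
Qed.

Lemma qmulVg : left_inverse qone qinv qmul.
Proof.
move=> x; apply/qclassP; apply: pg_trans (pg_mulVg (qrepr x)).
by apply: pg_mulE (pg_refl _); apply: qreprP.
Qed.

Lemma qmulgV : right_inverse qone qinv qmul.
Proof.
move=> x; apply/qclassP; apply: pg_trans (pg_mulgV (qrepr x)).
by apply: pg_mulE (pg_refl _) _; apply: qreprP.
Qed.

HB.instance Definition _ :=
  isGroup.Build quotient_group qmulA qmul1g qmulg1 qmulVg qmulgV.

Lemma qclassM x y : qclass (pg_mul x y) = (qclass x * qclass y)%g.
Proof. by apply/qclassP; apply: pg_mulE; apply/pg_sym/qreprP. Qed.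

End QuotientGroup.

Definition isomorphic (G H : groupType) : Prop :=
  exists f : {multiplicative G -> H}, bijective f.

Section Words.
Variables (A : Type) (inv : A -> A) (R : seq A -> Prop).

Definition winv (w : seq A) : seq A := rev (map inv w).

Inductive expand : seq A -> seq A -> Prop :=
| ExpandCancel u v a : expand (u ++ v) (u ++ [:: a; inv a] ++ v)
| ExpandRel u v r of R r : expand (u ++ v) (u ++ r ++ v).

Lemma expand_catl u v w : expand v w -> expand (u ++ v) (u ++ w).
Proof.
by case=> *; rewrite !(catA u); [apply: ExpandCancel | apply: ExpandRel].
Qed.

Lemma expand_catr u v w : expand v w -> expand (v ++ u) (w ++ u).
Proof.
by case=> *; rewrite -!catA; [apply: ExpandCancel | apply: ExpandRel].
Qed.

End Words.

Section EquivalenceClosure.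
Variables (T : Type) (E : T -> T -> Prop).

Definition eqclos : T -> T -> Prop := clos_refl_sym_trans T E.

Lemma eqclos_map (f : T -> T) :
  (forall x y, E x y -> E (f x) (f y)) ->
  forall x y, eqclos x y -> eqclos (f x) (f y).
Proof.
move=> Ef x y; elim=> {x y}; first by move=> x y /Ef; apply: rst_step.
- by move=> x; apply: rst_refl.
- by move=> x y _; apply: rst_sym.
- by move=> x y z _ xy _; apply: rst_trans.
Qed.

Lemma eqclos_inv (U : Type) (f : T -> U) :
  (forall x y, E x y -> f x = f y) -> forall x y, eqclos x y -> f x = f y.
Proof. by move=> Ef x y; elim=> {x y} // x y z _ -> _ ->. Qed.

End EquivalenceClosure.

Section Presentation.
Variables (S : choiceType) (R : seq (S * bool) -> Prop).

(* The letter (s, true) is the generator s and (s, false) its inverse. *)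
Definition letter_inv (a : S * bool) : S * bool := (a.1, ~~ a.2).

Definition weq : seq (S * bool) -> seq (S * bool) -> Prop :=
  eqclos (expand letter_inv R).

Lemma weq_cat u u' v v' : weq u u' -> weq v v' -> weq (u ++ v) (u' ++ v').
Proof.
move=> uu' vv'; apply: (@rst_trans _ _ _ (u' ++ v)).
  apply: (eqclos_map (f := fun w => w ++ v)) uu' => x y.
  exact: expand_catr.
by apply: eqclos_map vv' => x y; apply: expand_catl.
Qed.

Lemma letter_invK : involutive letter_inv.
Proof. by case=> s b; rewrite /letter_inv /= negbK. Qed.

Lemma weq_mulgV w : weq (w ++ winv letter_inv w) [::].
Proof.
elim: w => [|a w IHw]; first exact: rst_refl.
rewrite /winv /= rev_cons -cats1 -cat_cons catA.
apply: (@rst_trans _ _ _ [:: a; letter_inv a]); last first.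
  by apply/rst_sym/rst_step/(ExpandCancel _ _ [::] [::]).
rewrite /= -/([:: a] ++ _) -[[:: a; _]]/([:: a] ++ ([::] ++ [:: letter_inv a])).
by apply: weq_cat (rst_refl _ _ _) _; apply: weq_cat IHw (rst_refl _ _ _).
Qed.

Lemma weq_mulVg w : weq (winv letter_inv w ++ w) [::].
Proof.
have wK : winv letter_inv (winv letter_inv w) = w.
  rewrite /winv map_rev revK -map_comp (eq_map (g := id)) ?map_id //.
  exact: letter_invK.
by rewrite -{2}wK; apply: weq_mulgV.
Qed.

Definition words_pregroup : pregroup := {|
  pg_car := seq (S * bool);
  pg_eq := weq;
  pg_one := [::];
  pg_mul := cat;
  pg_inv := winv letter_inv;
  pg_refl := @rst_refl _ _;
  pg_sym := @rst_sym _ _;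
  pg_trans := @rst_trans _ _;
  pg_mulE := weq_cat;
  pg_mulA := fun x y z => eq_ind _ (weq (x ++ y ++ z)) (rst_refl _ _ _) _ (catA x y z);
  pg_mul1g := fun x => rst_refl _ _ _;
  pg_mulg1 := fun x => eq_ind_r (weq^~ x) (rst_refl _ _ _) (cats0 x);
  pg_mulVg := weq_mulVg;
  pg_mulgV := weq_mulgV |}.

(* <S | r = 1 for all r such that R r> *)
Definition presented_group : groupType := quotient_group words_pregroup.

End Presentation.

(* A graph in the sense of Serre: each edge is a pair of opposite darts
   (oriented edges), exchanged by the fixed-point-free involution [opp]. In
   particular a loop consists of two distinct darts. *)
Record graph := Graph {
  vertex : eqType;
  dart : choiceType;
  source : dart -> vertex;
  target : dart -> vertex;
  opp : dart -> dart;
  oppK : involutive opp;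
  opp_neq : forall e, opp e != e;
  source_opp : forall e, source (opp e) = target e }.

Fixpoint walk (K : graph) (x : vertex K) (s : seq (dart K)) (y : vertex K) :=
  if s is e :: s' then (source e == x) && walk (target e) s' y else x == y.

(* [attached s] means that at least one 2-cell is attached along the closed walk
   s; further 2-cells attached along the same walk, or along its inverse, do not
   affect the fundamental group. *)
Record complex2 := Complex2 {
  skeleton :> graph;
  attached : seq (dart skeleton) -> Prop;
  attached_closed : forall s, attached s -> exists x, walk x s x }.

Section Pi1.
Variables (K : complex2) (x0 : vertex K).
Implicit Types (s t : seq (dart K)) (x y z : vertex K).

Lemma target_opp (e : dart K) : target (opp e) = source e.
Proof. by rewrite -source_opp oppK. Qed.

Lemma walk_cat x y z s t : walk x s y -> walk y t z -> walk x (s ++ t) z.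
Proof.
elim: s x => [|e s IHs] x /=; first by move/eqP->.
by case/andP=> -> /IHs w /w.
Qed.

Lemma walk_winv x y s : walk x s y -> walk y (winv (@opp K) s) x.
Proof.
elim: s x => [|e s IHs] x /=; first by rewrite eq_sym.
case/andP=> /eqP sx /IHs w; rewrite /winv /= rev_cons -cats1.
by apply: walk_cat w _; rewrite /= source_opp target_opp sx !eqxx.
Qed.

Definition closed_walk := {s : seq (dart K) | walk x0 s x0}.
HB.instance Definition _ := Choice.on closed_walk.
Implicit Types p q : closed_walk.

Definition homotopic : closed_walk -> closed_walk -> Prop :=
  eqclos (fun p q => expand (@opp K) (@attached K) (val p) (val q)).

Definition walk_nil : closed_walk := exist _ [::] (eqxx x0).
Definition walk_mul p q : closed_walk :=
  exist _ (val p ++ val q) (walk_cat (valP p) (valP q)).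
Definition walk_opp p : closed_walk :=
  exist _ (winv (@opp K) (val p)) (walk_winv (valP p)).

Lemma homotopic_mul p p' q q' :
  homotopic p p' -> homotopic q q' -> homotopic (walk_mul p q) (walk_mul p' q').
Proof.
move=> pp' qq'; apply: (@rst_trans _ _ _ (walk_mul p' q)).
  apply: (eqclos_map (f := walk_mul^~ q)) pp' => u v.
  exact: expand_catr.
apply: (eqclos_map (f := walk_mul p')) qq' => u v.
exact: expand_catl.
Qed.

Lemma homotopic_mulA p q r :
  homotopic (walk_mul p (walk_mul q r)) (walk_mul (walk_mul p q) r).
Proof.
suff -> : walk_mul p (walk_mul q r) = walk_mul (walk_mul p q) r.
  exact: rst_refl.
by apply: val_inj; rewrite /= catA.
Qed.

Lemma homotopic_mul1g p : homotopic (walk_mul walk_nil p) p.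
Proof.
suff {2}<- : walk_mul walk_nil p = p by apply: rst_refl.
exact: val_inj.
Qed.

Lemma homotopic_mulg1 p : homotopic (walk_mul p walk_nil) p.
Proof.
suff {2}<- : walk_mul p walk_nil = p by apply: rst_refl.
by apply: val_inj; rewrite /= cats0.
Qed.

Lemma homotopic_mulgV p : homotopic (walk_mul p (walk_opp p)) walk_nil.
Proof.
case: p => s sP.
suff cancel u y (uP : walk x0 u y) :
    forall q, val q = u ++ winv (@opp K) u -> homotopic q walk_nil.
  exact: (cancel s x0 sP).
elim/last_ind: u y uP => [|u e IHu] y uP q.
  rewrite /winv /= => q0.
  by have ->: q = walk_nil; [apply: val_inj | apply: rst_refl].
rewrite -cats1 /winv map_cat rev_cat /= => qE.
have [z uz] : exists z, walk x0 u z.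
  elim: (u) x0 uP => [|a u' IHu'] x /=; first by exists x.
  by case/andP=> -> /IHu' [z]; exists z.
pose q' : closed_walk := exist _ (u ++ winv (@opp K) u) (walk_cat uz (walk_winv uz)).
apply: (@rst_trans _ _ _ q'); last exact: (IHu z uz).
apply/rst_sym/rst_step; rewrite /= qE -catA; exact: ExpandCancel.
Qed.

Lemma homotopic_mulVg p : homotopic (walk_mul (walk_opp p) p) walk_nil.
Proof.
have {2}<- : walk_opp (walk_opp p) = p.
  apply: val_inj; rewrite /= /winv map_rev revK -map_comp.
  rewrite (eq_map (g := id)) ?map_id //; exact: (@oppK K).
exact: homotopic_mulgV.
Qed.

Definition walk_pregroup : pregroup := {|
  pg_car := closed_walk;
  pg_eq := homotopic;
  pg_one := walk_nil;
  pg_mul := walk_mul;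
  pg_inv := walk_opp;
  pg_refl := @rst_refl _ _;
  pg_sym := @rst_sym _ _;
  pg_trans := @rst_trans _ _;
  pg_mulE := homotopic_mul;
  pg_mulA := homotopic_mulA;
  pg_mul1g := homotopic_mul1g;
  pg_mulg1 := homotopic_mulg1;
  pg_mulVg := homotopic_mulVg;
  pg_mulgV := homotopic_mulgV |}.

(* The edge-path group, i.e. the combinatorial description of the fundamental
   group of the 2-complex. *)
Definition pi1 : groupType := quotient_group walk_pregroup.

End Pi1.

(* (a, b) stands for the unit square [a, a+1] x [b, b+1]. *)
Definition square := (int * int)%type.

Definition white (s : square) : bool := (2 %| s.1 + s.2)%Z.
Definition adjacent (s t : square) : bool :=
  (`|s.1 - t.1| + `|s.2 - t.2| == 1)%N.

Section Domino.

(* The construction makes sense for every finite union D of unit squares. *)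
Variable D : {fset square}.
Implicit Types (A B d : {set D}) (T : {set {set D}}).

Definition balanced A : bool :=
  #|[set s in A | white (val s)]| == #|[set s in A | ~~ white (val s)]|.

Definition plug := {A : {set D} | balanced A}.
HB.instance Definition _ := Finite.on plug.

Lemma balanced0 : balanced set0.
Proof. by rewrite /balanced !setIdE !set0I. Qed.

Definition empty_plug : plug := exist _ set0 balanced0.

Definition domino d : bool :=
  [exists s : D, [exists t : D, adjacent (val s) (val t) && (d == [set s; t])]].

Definition tiling A T : bool := partition T A && [forall d in T, domino d].

Definition flip T T' : Prop :=
  exists s00 s10 s01 s11 : D,
    let: (a, b) := val s00 in
    [/\ val s10 = (a + 1, b), val s01 = (a, b + 1), val s11 = (a + 1, b + 1)
      & let H := [set [set s00; s10]; [set s01; s11]] in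
        let V := [set [set s00; s01]; [set s10; s11]] in
        (H \subset T /\ T' = (T :\: H) :|: V) \/
        (V \subset T /\ T' = (T :\: V) :|: H)].

(* (p, q, T, b) is the edge between p and q given by the tiling T, oriented from
   p to q. If p = q then disjointness forces p to be empty, T tiles D, and the
   edge is a loop, whose two orientations are told apart by the flag b. If
   p <> q the flag is always false. *)
Definition is_domino_dart (x : plug * plug * {set {set D}} * bool) : bool :=
  let: (p, q, T, b) := x in
  [&& [disjoint val p & val q], tiling (~: (val p :|: val q)) T & b ==> (p == q)].

Definition domino_dart := {x | is_domino_dart x}.
HB.instance Definition _ := Finite.on domino_dart.
Implicit Types e f : domino_dart.

Definition dsource e : plug := (val e).1.1.1.
Definition dtarget e : plug := (val e).1.1.2.
Definition dtiling e : {set {set D}} := (val e).1.2.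
Definition dflag e : bool := (val e).2.

Lemma dopp_subproof e :
  is_domino_dart
    (dtarget e, dsource e, dtiling e, (dsource e == dtarget e) (+) dflag e).
Proof.
case: e => [[[[p q] T] b] eP]; have /and3P[dpq tT bE] := eP.
rewrite /dsource /dtarget /dtiling /dflag /= disjoint_sym dpq setUC tT /=.
by rewrite (eq_sym q) {eP}; move: bE; case: (p == q); case: b.
Qed.

Definition dopp e : domino_dart :=
  exist _
    (dtarget e, dsource e, dtiling e, (dsource e == dtarget e) (+) dflag e)
    (dopp_subproof e).

Lemma doppK : involutive dopp.
Proof.
case=> [[[[p q] T] b] eP]; apply: val_inj.
rewrite /= /dsource /dtarget /dtiling /dflag /= (eq_sym q).
by rewrite addbA addbb.
Qed.

Lemma dopp_neq e : dopp e != e.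
Proof.
case: e => [[[[p q] T] b] eP]; apply/eqP => /(congr1 val).
rewrite /= /dsource /dtarget /dtiling /dflag /= => -[qp _].
by rewrite qp eqxx; case: b {eP}.
Qed.

Definition domino_graph : graph :=
  @Graph plug domino_dart dsource dtarget dopp doppK dopp_neq (fun _ => erefl).

(* In the third case p1, ..., p4 need not be distinct: p3 = p1 or p3 = p4 is
   possible when this plug is empty, and then e4 or e3 is a loop. The choice of
   its orientation is immaterial, as a disk is attached along its square. *)
Inductive domino_attached : seq (dart domino_graph) -> Prop :=
| AttachLoop f of dsource f = dtarget f :
    domino_attached [:: f; f]
| AttachFlip e1 e2 of
    dsource e1 = dsource e2 & dtarget e1 = dtarget e2 &
    dsource e1 <> dtarget e1 & flip (dtiling e1) (dtiling e2) :
    domino_attached [:: e1; dopp e2]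
| AttachQuad (p1 p2 p3 p4 : plug) d e1 e2 e3 e4 of
    domino d & [disjoint d & val p3] & val p2 = val p3 :|: d &
    (dsource e1, dtarget e1) = (p1, p2) &
    (dsource e2, dtarget e2) = (p2, p4) &
    (dsource e3, dtarget e3, dflag e3) = (p4, p3, false) &
    (dsource e4, dtarget e4, dflag e4) = (p3, p1, false) &
    dtiling e3 = d |: dtiling e2 & dtiling e4 = d |: dtiling e1 :
    domino_attached [:: e1; e2; e3; e4].

Lemma domino_attached_closed s :
  domino_attached s -> exists x, walk (K := domino_graph) x s x.
Proof.
case=> {s}.
- by move=> f fl; exists (dtarget f); rewrite /= fl !eqxx.
- by move=> e1 e2 s12 t12 _ _; exists (dsource e1); rewrite /= t12 s12 !eqxx.
- move=> p1 p2 p3 p4 d e1 e2 e3 e4 _ _ _ [s1 t1] [s2 t2] [s3 t3 _] [s4 t4 _] _ _.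
  by exists p1; rewrite /= s1 t1 s2 t2 s3 t3 s4 t4 !eqxx.
Qed.

Definition domino_complex : complex2 :=
  @Complex2 domino_graph domino_attached domino_attached_closed.

Definition domino_group : groupType := @pi1 domino_complex empty_plug.

Definition walk_parity (p : @closed_walk domino_complex empty_plug) : 'Z_2 :=
  (size (val p))%:R.

Definition parity (g : domino_group) : 'Z_2 := walk_parity (qrepr g).

Lemma walk_parity_homotopic p q :
  homotopic p q -> walk_parity p = walk_parity q.
Proof.
apply: eqclos_inv => {p q} p q; rewrite /walk_parity.
move: (val p) (val q) => s t [] => [u v a|u v r rP]; rewrite !size_cat !GRing.natrD.
  by congr (_ + _); rewrite -[LHS]GRing.add0r; congr (_ + _); apply: val_inj.
congr (_ + _); rewrite -[LHS]GRing.add0r; congr (_ + _).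
by case: rP => *; apply: val_inj.
Qed.

Lemma parity_qclass p : parity (qclass (P := walk_pregroup _) p) = walk_parity p.
Proof. exact: walk_parity_homotopic (@qreprP (walk_pregroup _) p). Qed.

(* The group law on 'Z_2 is addition. *)
Lemma parity_morphism : monoid_morphism (parity : domino_group -> 'Z_2).
Proof.
split; first by rewrite [LHS]parity_qclass; apply: val_inj.
move=> g h; rewrite [LHS]parity_qclass /walk_parity /= size_cat GRing.natrD.
by [].
Qed.

HB.instance Definition _ :=
  isUMagmaMorphism.Build domino_group 'Z_2 parity parity_morphism.

Definition parity_ker : pred domino_group := fun g => parity g == 1%g.

Lemma parity_ker_closed : group_closed parity_ker.
Proof.
split; first by rewrite unfold_in /parity_ker gmulf1.
move=> g h; rewrite !unfold_in => /eqP gE /eqP hE.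
by rewrite /parity_ker gmulfF /= gE hE divg1.
Qed.

Definition even_domino_carrier := {g : domino_group | parity_ker g}.
HB.instance Definition _ := SubChoice.on even_domino_carrier.
HB.instance Definition _ :=
  SubChoice_isSubGroup.Build domino_group parity_ker even_domino_carrier
    parity_ker_closed.

Definition even_domino_group : groupType := even_domino_carrier.

End Domino.

(* The unit squares of [0, L] x [0, 2]. *)
Definition rectangle2 (L : nat) : {fset square} :=
  [fset (i%:Z, j%:Z) | i in iota 0 L, j in iota 0 2]%fset.

Section GLplus.
Variable L : nat.

Definition symbolS := {i : int | (i != 0) && (`|i| <= L.-1./2)%N}.
HB.instance Definition _ := Choice.on symbolS.

(* The word a_m. It is empty for m = 0; the value for other m not indexing a
   symbol is irrelevant, as (m, n) in R_L implies |m|, |n| <= (L - 1) / 2. *)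
Definition gen (m : int) : seq (symbolS * bool) :=
  if insub m is Some i then [:: (i, true)] else [::].

Definition wcomm (S : choiceType) (u v : seq (S * bool)) : seq (S * bool) :=
  winv (@letter_inv S) u ++ winv (@letter_inv S) v ++ u ++ v.

Definition RL (m n : int) : bool :=
  (maxn (maxn `|m| `|n|) `|m - n| < L./2)%N.

Definition GLplus_relator (w : seq (symbolS * bool)) : Prop :=
  exists m n : int, RL m n /\ w = wcomm (gen m) (gen n).

Definition GLplus : groupType := presented_group GLplus_relator.

End GLplus.

(* Main.v *)
(** A plug is viewed as a configuration of L particles on the 2 x L ladder, a
    site being occupied iff it is white and filled or black and empty. A path
    p -> q -> r of two floors is homotopic to "add the dominoes of the first
    floor, then remove those of the second one", and adding a domino moves one
    particle from a black site to an adjacent white site. Hence the even domino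
    group is the fundamental group of the discrete configuration space of the
    particles, with the extra relation that two particles rotate around a unit
    square in either direction.

    The flux of a configuration at a column is its excess of particles to the
    left of that column. A domino move is then worth 1 if the domino is
    horizontal, and a_k^(+-1) if it is vertical with flux k: rotating two
    particles around a square shows that the value depends neither on the column
    nor on the rest of the configuration, and that it is trivial for k = 0, while
    two vertical moves of fluxes m and n fit in one configuration iff (m, n) is in
    R_L. Conversely, the product of these values along a walk is invariant under
    homotopy. *)

(* No map from the presented group to the domino group is written down explicitly. Labels take
   values in an arbitrary group [H], and [holonomy_classification] says that every labelling of the
   edges that respects the 2-cells is, on even closed walks, conjugate to the product of values
   given by a family [A] satisfying the relations. With the domino group as [H], and as labels the
   edges closed up by walks from the empty plug, this yields injectivity; surjectivity comes from
   explicit walks. The classification rests on a choice of gauge. On a path through all sites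
   particles cannot overtake one another, so commutation squares alone allow every move along the
   path to be given the value 1. The path follows the bottom row and comes back along the top row,
   hence only the vertical moves left of the last column remain, and these are compared by rotations
   around unit squares. The bound [3 <= L] enters with the flips: bigons are attached between
   distinct plugs only, so the flipped 2 x 2 block must not be the whole disk. *)
Require Import Defs.
From HB Require Import structures.
From Stdlib Require Import Relation_Operators.
From mathcomp Require Import all_boot all_order all_algebra all_fingroup.
From mathcomp Require Import generic_quotient finmap boolp zify.

Set Implicit Arguments.
Unset Strict Implicit.
Unset Printing Implicit Defensive.

Import GRing.Theory Num.Theory Order.TTheory.
Local Open Scope group_scope.

(** * Edge-path groups *)

Section EdgeClasses.
Variables (K : complex2) (x0 : vertex K) (c : vertex K -> seq (dart K)).
Hypothesis cP : forall x, walk x0 (c x) x.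
Implicit Types (s t u v : seq (dart K)) (x y : vertex K) (e : dart K).

Definition closed_of s (w : walk x0 s x0) : closed_walk x0 := exist (fun s => walk x0 s x0) s w.

Let G : groupType := @pi1 K x0.
Let cls (p : closed_walk x0) : G := qclass (P := walk_pregroup x0) p.

Lemma winv_cons e s : winv (@Defs.opp K) (e :: s) = winv (@Defs.opp K) s ++ [:: Defs.opp e].
Proof. by rewrite /winv /= rev_cons cats1. Qed.

Lemma winvK : involutive (winv (@Defs.opp K)).
Proof. by move=> s; rewrite /winv map_rev revK mapK //; apply: Defs.oppK. Qed.

(** Homotopies pass through closed walks only, so the backtracking is inserted one dart at a time,
    each stage being again a closed walk at [x0]. *)
Lemma homotopic_backtrack x y u v t (p q : closed_walk x0) :
  walk x t y -> walk x0 u y -> walk y v x0 ->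
  val p = u ++ v -> val q = u ++ winv (@Defs.opp K) t ++ t ++ v -> homotopic p q.
Proof.
elim: t x p q => [|e t IHt] x p q /=.
  move=> _ _ _ pE qE; have -> : p = q by apply: val_inj; rewrite /= pE qE.
  exact: rst_refl.
case/andP=> _ wt wu wv pE qE.
have wq : walk x0 (u ++ winv (@Defs.opp K) t ++ t ++ v) x0.
  by apply: walk_cat wu _; apply: walk_cat (walk_winv wt) _; apply: walk_cat wt wv.
pose q' : closed_walk x0 := closed_of wq.
apply: (@rst_trans _ _ _ q'); first exact: (IHt (target e)).
apply/rst_step; rewrite /= qE winv_cons -!catA /= !(catA u) -{2}(oppK e).
exact: (ExpandCancel _ _ _ (t ++ v)).
Qed.

Lemma edge_class_walk e :
  walk x0 (c (source e) ++ e :: winv (@Defs.opp K) (c (target e))) x0.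
Proof. by apply: walk_cat (cP _) _; rewrite /= eqxx /=; apply: walk_winv. Qed.

(** The usual generator of an edge-path group, the walks [c] replacing the branches of a maximal
    tree; no compatibility between these walks is required. *)
Definition edge_class e : G := cls (closed_of (edge_class_walk e)).

Lemma cls_nil u x (p : closed_walk x0) :
  walk x0 u x -> val p = u ++ winv (@Defs.opp K) u -> cls p = 1.
Proof.
move=> wu pE; apply/qclassP/rst_sym.
apply: (homotopic_backtrack (u := [::]) (v := [::]) (walk_winv wu)) => //=.
by rewrite pE cats0 winvK.
Qed.

Lemma edge_class_prod x y s (p : closed_walk x0) : walk x s y ->
  val p = c x ++ s ++ winv (@Defs.opp K) (c y) -> cls p = \prod_(e <- s) edge_class e.
Proof.
elim: s x p => [|e s IHs] x p /=.
  by move/eqP=> -> pE; rewrite big_nil; apply: cls_nil pE.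
case/andP=> /eqP <- ws pE; rewrite big_cons.
have wq : walk x0 (c (target e) ++ s ++ winv (@Defs.opp K) (c y)) x0.
  by apply: walk_cat (cP _) _; apply: walk_cat ws (walk_winv (cP _)).
rewrite -(IHs (target e) (closed_of wq)) // /edge_class /cls -qclassM.
apply/qclassP; apply: (homotopic_backtrack (u := c (source e) ++ [:: e])
  (v := s ++ winv (@Defs.opp K) (c y)) (cP (target e))) => //=.
- by apply: walk_cat (cP _) _; rewrite /= !eqxx.
- by apply: walk_cat ws (walk_winv (cP _)).
- by rewrite pE -catA.
- by rewrite -!catA.
Qed.

Lemma edge_class_relator x r : walk x r x ->
  expand (@Defs.opp K) (@attached K) [::] r ->
  \prod_(e <- r) edge_class e = 1.
Proof.
move=> wr er.
have wp : walk x0 (c x ++ r ++ winv (@Defs.opp K) (c x)) x0.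
  by apply: walk_cat (cP _) _; apply: walk_cat wr (walk_winv (cP _)).
rewrite -(edge_class_prod (p := closed_of wp) wr) //.
have wn : walk x0 (c x ++ winv (@Defs.opp K) (c x)) x0.
  by apply: walk_cat (cP _) (walk_winv (cP _)).
rewrite -(cls_nil (p := closed_of wn) (cP x)) //; apply/qclassP/rst_sym/rst_step => /=.
exact: (expand_catl _ (expand_catr _ er)).
Qed.

Lemma edge_class_attached s : attached s -> \prod_(e <- s) edge_class e = 1.
Proof.
move=> As; have [x ws] := attached_closed As; apply: (edge_class_relator ws).
by rewrite -[s]cats0; apply: (ExpandRel _ [::] [::] As).
Qed.

Lemma edge_class_opp e : edge_class (Defs.opp e) = (edge_class e)^-1.
Proof.
have w : walk (source e) [:: e; Defs.opp e] (source e).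
  by rewrite /= source_opp target_opp !eqxx.
have := edge_class_relator w (ExpandCancel _ _ [::] [::] e).
by rewrite !big_cons big_nil mulg1 => /mulg1_eq.
Qed.

(** The walk [c x0] may be nonempty; its class is the conjugating element. *)
Lemma edge_class_closed :
  exists a : G, forall p, \prod_(e <- val p) edge_class e = a * cls p * a^-1.
Proof.
exists (cls (closed_of (cP x0))) => p.
pose c0 : closed_walk x0 := closed_of (cP x0).
rewrite -(edge_class_prod (p := walk_mul c0 (walk_mul p (walk_opp c0))) (valP p)) //.
rewrite -mulgA [LHS]qclassM [X in _ * X]qclassM; congr (_ * (_ * _)).
by apply/esym/mulg1_eq; rewrite -qclassM; apply: cls_nil (cP x0) _.
Qed.

End EdgeClasses.

(** * Particles on the ladder *)

(* As in Newman's lemma, the diamond condition makes the product of the labels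
   along a maximal descending path independent of the path. *)
Lemma gauge_exists (H : groupType) (V : Type) (I : finType) (ok : V -> I -> bool)
    (mv : V -> I -> V) (rk : V -> nat) (N : V -> I -> H) :
  (forall x l, ok x l -> rk (mv x l) < rk x)%N ->
  (forall x l l', ok x l -> ok x l' -> l != l' ->
    [/\ ok (mv x l) l', ok (mv x l') l, mv (mv x l) l' = mv (mv x l') l
      & N x l * N (mv x l) l' = N x l' * N (mv x l') l]) ->
  exists h : V -> H, forall x l, ok x l -> N x l = h x * (h (mv x l))^-1.
Proof.
move=> rk_mv diamond.
(* The recursion follows moves and is not structural, so it runs on fuel; the value is stable once
   the fuel exceeds the rank. *)
pose hf := fix hf (n : nat) (x : V) {struct n} : H := if n is n'.+1 then
  (if [pick l | ok x l] is Some l then N x l * hf n' (mv x l) else 1) else 1.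
have hfS n x :
    hf n.+1 x = if [pick l | ok x l] is Some l then N x l * hf n (mv x l) else 1 by [].
clearbody hf.
have fuel n m x : (rk x < n)%N -> (rk x < m)%N -> hf n x = hf m x.
  elim: n m x => [|n IHn] [|m] x // xn xm; rewrite !hfS; case: pickP => // l xl.
  by rewrite (IHn m) //; apply: leq_trans (rk_mv _ _ xl) _.
pose h x := hf (rk x).+1 x; exists h.
suff main n x l : (rk x < n)%N -> ok x l -> h x = N x l * h (mv x l).
  by move=> x l xl; rewrite (main _ _ _ (ltnSn _) xl) mulgK.
elim: n x l => // n IHn x l xn xl.
have -> : h x = if [pick l | ok x l] is Some l then N x l * h (mv x l) else 1.
  rewrite /h hfS; case: pickP => // k xk.
  by congr (_ * _); apply: fuel; rewrite ?rk_mv.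
case: pickP => [k xk|/(_ l)]; last by rewrite xl.
have [->//|kl] := eqVneq k l.
have [okl olk e1 e2] := diamond _ _ _ xk xl kl.
have lt z : ok x z -> (rk (mv x z) < n)%N.
  by move=> xz; apply: leq_trans (rk_mv _ _ xz) _.
by rewrite (IHn _ l (lt _ xk) okl) (IHn _ k (lt _ xl) olk) !mulgA e2 e1.
Qed.

Section Sites.
Variable L : nat.

Definition site := ('I_L * bool)%type.
HB.instance Definition _ := Finite.on site.
Implicit Types (X Y S : {set site}) (s t c : site).

Definition adj s t :=
  ((s.1 == t.1) && (s.2 != t.2)) ||
  ((s.2 == t.2) && ((s.1.+1 == t.1 :> nat) || (t.1.+1 == s.1 :> nat))).

Definition mv X s t := t |: (X :\ s).

Definition movable X s t := [&& s \in X, t \notin X & adj s t].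

Lemma adjC s t : adj s t = adj t s.
Proof.
by rewrite /adj; congr (_ && _ || _ && _); rewrite 1?eq_sym // orbC.
Qed.

Lemma adj_neq s t : adj s t -> s != t.
Proof.
by apply: contraTneq => ->; rewrite /adj !eqxx /= gtn_eqF.
Qed.

Lemma in_mv X s t c : (c \in mv X s t) = (c == t) || ((c != s) && (c \in X)).
Proof. by rewrite !inE. Qed.

Lemma mvK X s t : s \in X -> t \notin X -> mv (mv X s t) t s = X.
Proof.
move=> sX tX; apply/setP=> c; rewrite !in_mv.
have [->|cs] := eqVneq c s; first by rewrite sX.
by have [->|] := eqVneq c t; rewrite //= (negbTE tX).
Qed.

Lemma mvC X s t s' t' : s \in X -> t \notin X -> s' \in X -> t' \notin X ->
  mv (mv X s t) s' t' = mv (mv X s' t') s t.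
Proof.
move=> sX tX s'X t'X; apply/setP=> c; rewrite !in_mv.
have ts' : t != s' by apply: contraNneq tX => ->.
have t's : t' != s by apply: contraNneq t'X => ->.
have [->|ct] := eqVneq c t; first by rewrite ts' orbT.
by have [->|ct'] := eqVneq c t'; [rewrite t's | rewrite /= andbCA].
Qed.

Lemma mv_swap X s t s' t' :
  s \in X -> t \notin X -> s' \in X -> t' \notin X ->
  mv (mv X s t) s' t' = mv (mv X s t') s' t.
Proof.
move=> sX tX s'X t'X; apply/setP=> c; rewrite !in_mv.
have ts' : t != s' by apply: contraNneq tX => ->.
have t's' : t' != s' by apply: contraNneq t'X => ->.
have [->|ct] := eqVneq c t; first by rewrite ts' orbT.
by have [->|ct'] := eqVneq c t'; rewrite ?t's'.
Qed.

Lemma card_mv X s t : s \in X -> t \notin X -> #|mv X s t| = #|X|.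
Proof. by move=> sX tX; rewrite cardsU1 !inE (negbTE tX) andbF (cardsD1 s X) sX. Qed.

Lemma movable_mv X s t : movable X s t -> movable (mv X s t) t s.
Proof.
case/and3P=> sX tX st; rewrite /movable adjC st !in_mv eqxx /=.
by rewrite eqxx (negbTE (adj_neq st)).
Qed.

Lemma movable_mv2 X s t s' t' :
  movable X s t -> movable X s' t' -> s != s' -> t != t' ->
  movable (mv X s t) s' t'.
Proof.
case/and3P=> sX tX _ /and3P[s'X t'X s't'] ss' tt'.
rewrite /movable s't' !in_mv s'X (negbTE t'X) andbF orbF (eq_sym s' s) ss' orbT.
by rewrite (eq_sym t' t) tt'.
Qed.

(* Both configurations are connected to the one in which the particles of [S] are
   packed at the lowest positions. *)
Lemma config_connected S (p : site -> nat) (Q : {set site} -> Prop) :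
  {in S &, injective p} ->
  (forall c, c \in S -> (0 < p c)%N -> exists2 c', c' \in S & p c = (p c').+1) ->
  (forall X s t, s \in S -> t \in S -> s \in X -> t \notin X ->
    p s = (p t).+1 \/ p t = (p s).+1 -> Q X -> Q (mv X s t)) ->
  forall X Y, X :\: S = Y :\: S -> #|X :&: S| = #|Y :&: S| -> Q X -> Q Y.
Proof.
move=> pI pS Qmv; pose r X := (\sum_(c in X :&: S) p c)%N.
pose low X := [forall s in S, forall t in S,
  (p s == (p t).+1) ==> (s \in X) ==> (t \in X)].
have mvI X s t : t \in S -> mv X s t :&: S = mv (X :&: S) s t.
  move=> tS; apply/setP=> c; rewrite !inE.
  by have [->|] := eqVneq c t; rewrite ?tS //= andbA.
have mvD X s t : s \in S -> t \in S -> mv X s t :\: S = X :\: S.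
  move=> sS tS; apply/setP=> c; rewrite !inE.
  have [->|_] := eqVneq c t; first by rewrite tS.
  by have [->|_] := eqVneq c s; rewrite ?sS.
have mvc X s t : s \in S -> t \in S -> s \in X -> t \notin X ->
    #|mv X s t :&: S| = #|X :&: S|.
  by move=> sS tS sX tX; rewrite mvI // card_mv // !inE ?sX ?sS ?(negbTE tX).
have rmv X s t : s \in S -> t \in S -> s \in X -> t \notin X -> p s = (p t).+1 ->
    (r (mv X s t) < r X)%N.
  move=> sS tS sX tX st; rewrite /r mvI // /mv big_setU1 ?inE ?(negbTE tX) ?andbF //=.
  rewrite [X in (_ < X)%N](big_setD1 s) ?inE ?sX ?sS //= ltn_add2r st //.
have lowP X : ~~ low X -> exists s t, [/\ s \in S, t \in S, s \in X, t \notin X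
    & p s = (p t).+1].
  case/forall_inPn=> s sS /forall_inPn[t tS].
  rewrite !negb_imply => /and3P[/eqP st sX tX]; by exists s, t.
have lowS X s t : low X -> s \in S -> t \in S -> (p t <= p s)%N -> s \in X -> t \in X.
  move=> /forall_inP lX; elim: {s}(p s) {-2}s (erefl (p s)) => [|n IHn] s sn sS tS.
    by rewrite sn leqn0 => /eqP t0; rewrite (pI t s) // t0.
  rewrite leq_eqVlt => /orP[/eqP/pI-> // | lt sX].
  have [s' s'S ss'] : exists2 c', c' \in S & p s = (p c').+1 by apply: pS; rewrite ?sn.
  apply: (IHn s'); rewrite ?s'S //; [by move: ss'; rewrite sn => -[] | | ].
    by rewrite -ltnS -ss'.
  have /forall_inP/(_ _ s'S) := lX _ sS; by rewrite ss' eqxx sX.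
(* Within [S] a low configuration is an initial segment of positions, so two of them are nested. *)
have lowE X Y : low X -> low Y -> #|X :&: S| = #|Y :&: S| -> X :&: S = Y :&: S.
  move=> lX lY XY; have [sub|] := boolP (X :&: S \subset Y :&: S).
    by apply/eqP; rewrite eqEcard sub XY /=.
  case/subsetPn=> c; rewrite !inE => /andP[cX cS]; rewrite cS andbT => cY.
  apply/esym/eqP; rewrite eqEcard XY leqnn andbT; apply/subsetP=> d.
  rewrite !inE => /andP[dY dS]; rewrite dS andbT; apply: (lowS X c d) => //.
  by rewrite leqNgt; apply: contra cY => /ltnW cd; apply: (lowS Y d c).
move=> X Y; have [n] := ubnP (r X + r Y)%N.
elim: n X Y => [|n IHn] X Y lt XYD XYc QX; first by rewrite ltn0 in lt.
have [lX|/lowP[s [t [sS tS sX tX st]]]] := boolP (low X); last first.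
  apply: (IHn (mv X s t)); rewrite ?mvD ?mvc //; last by apply: Qmv => //; left.
  by rewrite ltnS in lt; apply: leq_trans lt; rewrite -addSn leq_add2r rmv.
have [lY|/lowP[s [t [sS tS sY tY st]]]] := boolP (low Y); last first.
  (* [Y] is recovered from its lowered version by the reverse move, which is why [Q] has to pass
     along moves in both directions. *)
  rewrite -(mvK sY tY); apply: Qmv => //; rewrite ?in_mv ?eqxx //.
  - by rewrite orbF; apply: contraNneq tY => <-.
  - by right.
  apply: (IHn X); rewrite ?mvD ?mvc //.
  by rewrite ltnS in lt; apply: leq_trans lt; rewrite -addnS leq_add2l rmv.
by rewrite -(setID Y S) -XYD -(lowE X Y) // setID.
Qed.

End Sites.

(** * The flux of a configuration *)

Section Flux.
Variable L : nat.
Implicit Types (X Y : {set site L}) (s t c : site L) (i : 'I_L) (b : bool).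

Definition column X (j : nat) : {set site L} := [set c in X | c.1 == j :> nat].

(** Discounting one particle per column makes the flux of [L] particles vanish at both ends of the
    ladder. *)
Definition flux X (j : nat) : int := (\sum_(i < j) (#|column X i|%:Z - 1))%R.

Lemma flux0 X : flux X 0 = 0%R.
Proof. by rewrite /flux big_ord0. Qed.

Lemma fluxS X j : flux X j.+1 = (flux X j + (#|column X j|%:Z - 1))%R.
Proof. by rewrite /flux big_ord_recr. Qed.

Lemma card_column X i : #|column X i| = (((i, false) \in X) + ((i, true) \in X))%N.
Proof.
rewrite (cardsD1 (i, false)) (cardsD1 (i, true)) !inE /= eqxx !andbT addnA.
rewrite xpair_eqE eqxx /= -[RHS]addn0; congr (_ + _)%N.
apply: eq_card0 => -[k b]; rewrite !inE /= !xpair_eqE (val_eqE k i).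
by case: eqP => [->|_]; case: b; rewrite ?andbF.
Qed.

Lemma card_column_le X j : (#|column X j| <= 2)%N.
Proof.
have [jL|Lj] := ltnP j L; first by
  rewrite -[j]/(val (Ordinal jL)) card_column; do 2!case: (_ \in X).
rewrite eq_card0 // => c; rewrite !inE [_ == j]ltn_eqF ?andbF //.
exact: leq_trans (ltn_ord _) Lj.
Qed.

Lemma card_lt_column X j : (#|[set c in X | c.1 < j]%N|%:Z = flux X j + j%:Z)%R.
Proof.
elim: j => [|j IHj].
  by rewrite flux0 eq_card0 // => c; rewrite !inE ltn0 andbF.
have -> : [set c in X | c.1 < j.+1]%N = [set c in X | c.1 < j]%N :|: column X j.
  by apply/setP=> c; rewrite !inE -andb_orr ltnS leq_eqVlt orbC.
rewrite cardsU disjoint_setI0 ?cards0 ?subn0.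
  by rewrite fluxS PoszD IHj; lia.
by apply/pred0P => c; rewrite !inE; case: (ltngtP c.1 j); rewrite ?andbF.
Qed.

Lemma flux_full X : flux X L = (#|X|%:Z - L%:Z)%R.
Proof.
have := card_lt_column X L; rewrite (_ : [set c in X | _] = X) => [->|]; first by lia.
by apply/setP=> c; rewrite !inE ltn_ord andbT.
Qed.

Lemma flux_lip X j d : (`|flux X (j + d) - flux X j| <= d)%N.
Proof.
elim: d => [|d IHd]; first by rewrite addn0 subrr.
by rewrite addnS fluxS; have := card_column_le X (j + d); lia.
Qed.

Lemma flux_le X j : (`|flux X j| <= j)%N.
Proof. by have := flux_lip X 0 j; rewrite flux0 subr0. Qed.

Lemma flux_mv_vertical X i b : (i, b) \in X -> (i, ~~ b) \notin X ->
  flux (mv X (i, b) (i, ~~ b)) =1 flux X.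
Proof.
move=> iX inX j; rewrite /flux; apply: eq_bigr => -[k kj] _ /=; congr (Posz _ - _)%R.
have [ik|ik] := eqVneq (val i) k; last first.
  apply: eq_card => -[k' b']; rewrite !inE /=.
  have [ck|] := eqVneq (val k') k; rewrite ?andbF // !andbT.
  have k'i : (k' == i) = false by apply: contraNF ik => /eqP <-; rewrite ck.
  by rewrite !xpair_eqE k'i.
rewrite -ik !card_column !in_mv /= !xpair_eqE !eqxx /=.
by case: b iX inX => /= -> /negbTE->.
Qed.

(* [F] prescribes the flux; where it is constant the column gets one particle, at
   the bottom. *)
Lemma config_exists (F : nat -> int) : F 0 = 0%R -> F L = 0%R ->
  (forall j, (j < L)%N -> `|F j.+1 - F j| <= 1)%N ->
  exists X, [/\ #|X| = L, forall j, (j <= L)%N -> flux X j = F j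
    & forall i, F i.+1 = F i -> (i, false) \in X /\ (i, true) \notin X].
Proof.
move=> F0 FL FS.
pose X := [set c : site L | (F c.1.+1 == F c.1 + 1)%R || (F c.1.+1 == F c.1) && ~~ c.2].
have XF j : (j <= L)%N -> flux X j = F j.
  elim: j => [|j IHj] jL; first by rewrite flux0.
  rewrite fluxS IHj ?(ltnW jL) // -[j in column X j]/(val (Ordinal jL)) card_column !inE /=.
  have := FS j jL; rewrite andbT andbF orbF.
  by case: eqP => [->|]; [lia|]; case: eqP => [->|] /=; lia.
exists X; split=> //.
  by have := flux_full X; rewrite XF // FL; lia.
move=> i Fi; rewrite !inE /= Fi eqxx /=; split; first by rewrite orbT.
by rewrite orbF; apply/eqP; lia.
Qed.

End Flux.

(** * Flat connections on configurations *)

Section Flat.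
Variables (L : nat) (H : groupType).
Implicit Types (X Y : {set site L}) (s t c : site L) (i j : 'I_L) (b : bool).
Implicit Types (N : {set site L} -> site L -> site L -> H).

(* [N X s t] is the value on the move of a particle of [X] from [s] to [t]. The
   last clause makes two particles rotating clockwise around a unit square
   equivalent to the same two particles rotating counterclockwise. *)
Definition flat N : Prop :=
  [/\ forall X s t, #|X| = L -> movable X s t -> N (mv X s t) t s = (N X s t)^-1,
      forall X s t s' t', #|X| = L -> movable X s t -> movable X s' t' ->
        s != s' -> t != t' ->
        N X s t * N (mv X s t) s' t' = N X s' t' * N (mv X s' t') s t
    & forall X s s' t t', #|X| = L -> movable X s t -> movable X s t' ->
        movable X s' t -> movable X s' t' -> s != s' -> t != t' ->
        N X s t * N (mv X s t) s' t' = N X s t' * N (mv X s t') s' t].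

Definition gauge N (h : {set site L} -> H) X s t : H :=
  (h X)^-1 * N X s t * h (mv X s t).

Lemma flat_gauge N h : flat N -> flat (gauge N h).
Proof.
have cancel (x a b : H) y : x * a * h y * ((h y)^-1 * b) = x * a * b.
  by rewrite !mulgA mulgK.
case=> N1 N2 N3; split=> [X s t XL st|X s t s' t' XL st st' ss' tt'
  |X s s' t t' XL st st' s't s't' ss' tt']; rewrite /gauge.
- case/and3P: (st) => sX tX _; rewrite mvK // N1 // !invgM invgK mulgA.
  by [].
- rewrite -!(mulgA (h _)^-1 (N (mv _ _ _) _ _)) !cancel !mulgA.
  have := (st, st') => -[/and3P[sX tX _] /and3P[s'X t'X _]].
  by rewrite -!(mulgA (h X)^-1) N2 // mvC.
- rewrite -!(mulgA (h _)^-1 (N (mv _ _ _) _ _)) !cancel !mulgA.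
  have := (st, s't') => -[/and3P[sX tX _] /and3P[s'X t'X _]].
  by rewrite -!(mulgA (h X)^-1) N3 // mv_swap.
Qed.

(* The position of a site along the path that runs along the bottom row to the
   right and comes back along the top row. *)
Definition pos c : nat := if c.2 then (2 * L).-1 - c.1 else c.1.

Lemma pos_inj : injective pos.
Proof.
move=> [[i iL] b] [[i' iL'] b'] /=; rewrite /pos /= => e.
have ii' : i = i' by case: b b' e => -[] /=; lia.
have bb' : b = b' by case: b b' e => -[] /=; lia.
by rewrite -bb'; congr (_, _); apply: val_inj.
Qed.

Lemma pos_adj s t : pos s = (pos t).+1 -> adj s t.
Proof.
case: s t => [[i iL] b] [[i' iL'] b']; rewrite /pos /adj -val_eqE /=.
by case: b b' => -[] /=; lia.
Qed.

(** Particles on a path keep their order, so up to backtracking the loops of moves along it are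
    generated by commutation squares, and the connection can be made trivial there. *)
Lemma flat_trivialize N : flat N ->
  exists h, forall X s t, #|X| = L -> movable X s t ->
    pos s = (pos t).+1 \/ pos t = (pos s).+1 -> gauge N h X s t = 1.
Proof.
move=> flatN; case: (flatN) => N1 N2 N3.
pose ok X (e : site L * site L) :=
  [&& #|X| == L, movable X e.1 e.2 & pos e.1 == (pos e.2).+1].
pose m X (e : site L * site L) := mv X e.1 e.2.
pose rk X := (\sum_(c in X) pos c)%N.
(* Only the moves that lower a position are used, ranked by the total position. Two distinct ones
   differ both in source and in target, so the commutation square of [flat] is the diamond. *)
have [||h hP] := @gauge_exists H _ _ ok m rk (fun X e => N X e.1 e.2).
- move=> X [s t] /and3P[_ /= /and3P[sX tX _] /eqP st].
  rewrite /rk /m /= big_setU1 ?inE ?(negbTE tX) ?andbF //=.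
  by rewrite [X in (_ < X)%N](big_setD1 s) //= ltn_add2r st.
- move=> X [s t] [s' t'] /and3P[/eqP XL /= st /eqP pst] /and3P[_ /= st' /eqP pst'] ne.
  have ss' : s != s'.
    apply: contra_neq ne => ss'; congr (_, _) => //; apply: pos_inj.
    by apply: succn_inj; rewrite -pst -pst' ss'.
  have tt' : t != t'.
    by apply: contra_neq ss' => tt'; apply: pos_inj; rewrite pst pst' tt'.
  have := (st, st') => -[/and3P[sX tX _] /and3P[s'X t'X _]].
  rewrite /ok /m /= pst pst' !eqxx !card_mv // XL eqxx !andbT.
  by rewrite !movable_mv2 // 1?eq_sym // N2 // mvC.
exists h; suff main X s t : #|X| = L -> movable X s t -> pos s = (pos t).+1 ->
    gauge N h X s t = 1.
  move=> X s t XL st [pst|pts]; first exact: main.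
  case: (flat_gauge h flatN) => G1 _ _; case/and3P: (st) => sX tX _.
  rewrite -[LHS]invgK -G1 // main ?invg1 //; first by rewrite card_mv.
  exact: movable_mv.
move=> XL st pst; have e : ok X (s, t) by rewrite /ok /= XL st pst !eqxx.
by rewrite /gauge (hP _ _ e) mulKg mulVg.
Qed.

End Flat.

(** * Vertical moves in a fixed column depend on the flux only *)

Section Rigidity.
Variables (L : nat) (H : groupType) (N : {set site L} -> site L -> site L -> H).
Implicit Types (X Y : {set site L}) (s t c : site L) (i j : 'I_L) (b : bool).
Hypothesis flatN : flat N.
Hypothesis N_path : forall X s t, #|X| = L -> movable X s t ->
  pos s = (pos t).+1 \/ pos t = (pos s).+1 -> N X s t = 1.

Let trivial s t := forall X, #|X| = L -> movable X s t -> N X s t = 1.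

(** Each row is a run of the path, so horizontal neighbours are consecutive on it. *)
Lemma trivial_horizontal s t : s.2 = t.2 -> adj s t -> trivial s t.
Proof.
move=> st a X XL m; apply: N_path => //.
case: s t st a {X XL m} => [[i iL] b] [[i' iL'] b'] /= <-.
by rewrite /pos /adj /= !eqxx /= andbF /= => /orP[] /eqP <-; case: b; lia.
Qed.

(** A move inside [S] commutes with the move from [s] to [t]. Two sides of the commutation square
    are trivial, so the other two have the same value. *)
Lemma N_slide (S : {set site L}) (p : site L -> nat) s t X Y :
  {in S &, injective p} ->
  (forall c, c \in S -> (0 < p c)%N -> exists2 c', c' \in S & p c = (p c').+1) ->
  (forall c c', c \in S -> c' \in S -> p c = (p c').+1 ->
    [/\ adj c c', trivial c c' & trivial c' c]) ->
  s \notin S -> t \notin S -> #|X| = L -> #|Y| = L -> X :\: S = Y :\: S ->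
  movable X s t -> N X s t = N Y s t.
Proof.
move=> pI pS pT sS tS XL YL XY Xst; apply/esym.
pose Q (Z : {set site L}) := #|Z| = L /\ movable Z s t /\ N Z s t = N X s t.
suff [] : Q Y by move=> _ [].
apply: (config_connected pI pS _ XY) => //; last first.
  have := etrans XL (esym YL); by rewrite -(cardsID S X) -(cardsID S Y) XY => /addIn.
move=> Z c c' cS c'S cZ c'Z pcc' [ZL [Zst NZ]].
have [cc' T] : adj c c' /\ trivial c c'.
  by case: pcc' => /pT[] // *; rewrite // adjC.
have Zcc' : movable Z c c' by rewrite /movable cZ c'Z.
have sc : s != c by apply: contraNneq sS => ->.
have tc' : t != c' by apply: contraNneq tS => ->.
split; first by rewrite card_mv.
split; first by apply: movable_mv2; rewrite // eq_sym.
case: flatN => _ N2 _.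
have := N2 _ _ _ _ _ ZL Zst Zcc' sc tc'; rewrite NZ (T Z) // mul1g => <-.
rewrite T ?mulg1 //; last exact: movable_mv2.
by case/and3P: Zst => sZ tZ _; rewrite card_mv.
Qed.

Lemma flux_eq X Y k : (forall c, c.1 < k -> (c \in X) = (c \in Y))%N ->
  flux X k = flux Y k.
Proof.
move=> XY; rewrite /flux; apply: eq_bigr => l _; congr (Posz _ - _)%R.
by apply: eq_card => c; rewrite !inE; case: eqP => [cl|]; rewrite ?andbF // XY ?cl.
Qed.

(** The sites to the right of column [j] form an interval of the path [pos]. *)
Lemma N_slide_right j s t X Y : s.1 = j -> t.1 = j -> #|X| = L -> #|Y| = L ->
  (forall c, c.1 <= j -> (c \in X) = (c \in Y))%N -> movable X s t ->
  N X s t = N Y s t.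
Proof.
move=> sj tj XL YL XY.
apply: (@N_slide [set c : site L | j < c.1]%N (fun c => (pos c - j.+1)%N) s t X Y);
  rewrite ?inE ?sj ?tj ?ltnn //.
- move=> c c'; rewrite !inE => jc jc' pcc'; apply: pos_inj; move: jc jc' pcc'.
  by case: c c' => [[i iL] b] [[i' iL'] b']; rewrite /pos /=; case: b b' => -[]; lia.
- move=> [i b]; rewrite inE /pos /= => ji; case: b => /= p0; last first.
    have iL : (i.-1 < L)%N by have := ltn_ord i; lia.
    by exists (Ordinal iL, false); rewrite ?inE /=; lia.
  have [iL|iL] := ltnP i.+1 L.
    by exists (Ordinal iL, true); rewrite ?inE /=; lia.
  by exists (i, false); rewrite ?inE //=; have := ltn_ord i; lia.
- move=> c c'; rewrite !inE => jc jc' pcc'.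
  have e : pos c = (pos c').+1.
    move: jc jc' pcc'; case: c c' => [[i iL] b] [[i' iL'] b'].
    by rewrite /pos /=; case: b b' => -[]; lia.
  split; first exact: pos_adj.
    by move=> Z ZL m; apply: N_path => //; left.
  by move=> Z ZL m; apply: N_path => //; right.
- apply/setP=> c; rewrite !inE -leqNgt; case: leqP => //= cj.
  exact: XY.
Qed.

Lemma movable_vertical X j b :
  movable X (j, b) (j, ~~ b) = ((j, b) \in X) && ((j, ~~ b) \notin X).
Proof. by rewrite /movable /adj /= eqxx; case: b; rewrite ?andbT. Qed.

Lemma flux_vertical X j b : movable X (j, b) (j, ~~ b) -> flux X j.+1 = flux X j.
Proof.
rewrite movable_vertical fluxS card_column => /andP[].
by case: b => /= -> /negbTE->; rewrite ?addn0 ?add0n subrr addr0.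
Qed.

(* By descending induction on [j]: the sites to the right of column [j] are half
   full, so they can be rearranged until column [j.+1] admits the move opposite to
   the one in column [j]; rotating both particles relates the two columns. *)
Lemma N_flux0 j b X : #|X| = L -> movable X (j, b) (j, ~~ b) -> flux X j = 0%R ->
  N X (j, b) (j, ~~ b) = 1.
Proof.
have [n] := ubnP (L - j)%N; elim: n j b X => [|n IHn] j b X.
  by rewrite ltn0.
move=> jn XL Xj Xj0; have [j'L|Lj] := ltnP j.+1 L; last first.
  (* In the last column the vertical move is the turn of the path. *)
  by apply: N_path => //; rewrite /pos /=; have := ltn_ord j; case: (b) => /=; lia.
(* To the right of column [j] exactly the row opposite to the particle of column [j] is filled: each
   of these columns holds one particle, so the flux stays 0, and column [j.+1] admits the opposite
   move. *)
pose Y := [set c in X | c.1 <= j]%N :|: [set c : site L | (j < c.1)%N && (c.2 == ~~ b)].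
have XY c : (c.1 <= j)%N -> (c \in Y) = (c \in X).
  by move=> cj; rewrite !inE cj andbT ltnNge cj orbF.
have Yin c : (j < c.1)%N -> (c \in Y) = (c.2 == ~~ b).
  by move=> jc; rewrite !inE jc leqNgt jc andbF.
have Yj : movable Y (j, b) (j, ~~ b) by move: Xj; rewrite !movable_vertical !XY.
have fY : flux Y j.+1 = 0%R.
  rewrite (flux_vertical Yj) -Xj0; apply: flux_eq => c cj; exact/XY/ltnW.
have YL : #|Y| = L.
  suff fYd d : (j.+1 + d <= L)%N -> flux Y (j.+1 + d) = 0%R.
    have := fYd (L - j.+1)%N; rewrite subnKC // flux_full => /(_ (leqnn _)).
    by lia.
  elim: d => [|d IHd] dL; first by rewrite addn0.
  rewrite addnS fluxS IHd; last by lia.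
  rewrite -[X in column Y X]/(val (Ordinal (ltac:(lia) : (j.+1 + d < L)%N))).
  by rewrite card_column !Yin /=; [case: (b) | lia | lia].
have -> : N X (j, b) (j, ~~ b) = N Y (j, b) (j, ~~ b).
  by apply: (N_slide_right (j := j)) => // c cj; rewrite XY.
pose j' := Ordinal j'L.
move: (Yj); rewrite movable_vertical => /andP[jY jnY].
have j'Y : (j', ~~ b) \in Y by rewrite Yin //=.
have j'nY : (j', b) \notin Y by rewrite Yin //=; case: (b).
have h1 : adj (j, b) (j', b) by rewrite /adj /= !eqxx orbT.
have h2 : adj (j', ~~ b) (j, ~~ b) by rewrite adjC /adj /= !eqxx orbT.
have m1 : movable Y (j, b) (j', b) by rewrite /movable jY j'nY.
have m2 : movable Y (j', ~~ b) (j, ~~ b) by rewrite /movable j'Y jnY.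
have m3 : movable Y (j', ~~ b) (j', b).
  by rewrite -[b in X in movable _ _ X]negbK movable_vertical negbK j'Y.
have jj' : (j == j') = false by rewrite -val_eqE /= ltn_eqF.
have ne1 : (j, b) != (j', ~~ b) by rewrite xpair_eqE jj'.
have ne2 : (j, ~~ b) != (j', b) by rewrite xpair_eqE jj'.
case: flatN => _ _ N3; have := N3 _ _ _ _ _ YL Yj m1 m2 m3 ne1 ne2.
rewrite (trivial_horizontal _ h1) // (trivial_horizontal _ h2) //; last first.
- by apply: movable_mv2 => //; rewrite eq_sym.
- by rewrite card_mv.
rewrite mulg1; have -> : N (mv Y (j, b) (j, ~~ b)) (j', ~~ b) (j', b) = 1.
  rewrite -[b in X in N _ _ X]negbK; apply: IHn.
  - by move: jn (ltn_ord j); clear; rewrite /=; lia.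
  - by rewrite card_mv.
  - by rewrite negbK; apply: movable_mv2.
  - by rewrite flux_mv_vertical.
by rewrite mulg1.
Qed.

(** The sites to the left of column [j] form two pieces of the path [pos]. They are joined into one
    path by the vertical step in column 0, where the flux is 0, so that this step is trivial by
    [N_flux0]. *)
Lemma N_slide_left j s t X Y : s.1 = j -> t.1 = j -> #|X| = L -> #|Y| = L ->
  (forall c, j <= c.1 -> (c \in X) = (c \in Y))%N -> movable X s t ->
  N X s t = N Y s t.
Proof.
move=> sj tj XL YL XY; apply: (@N_slide [set c : site L | c.1 < j]%N
  (fun c => if c.2 then (j.-1 - c.1)%N else (j + c.1)%N) s t X Y); rewrite ?inE ?sj ?tj ?ltnn //.
- move=> [[i iL] b] [[i' iL'] b']; rewrite !inE /= => ij i'j e.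
  have ii' : i = i' by case: b b' e => -[] /=; lia.
  have bb' : b = b' by case: b b' e => -[] /=; lia.
  by rewrite -bb'; congr (_, _); apply: val_inj.
- move=> [i b]; rewrite inE /= => ij; case: b => /= p0.
    by exists (Ordinal (ltac:(have := ltn_ord j; lia) : (i.+1 < L)%N), true);
      rewrite ?inE /=; lia.
  have [i0|i0] := posnP i.
    by exists (i, true); rewrite ?inE //=; lia.
  by exists (Ordinal (ltac:(have := ltn_ord j; lia) : (i.-1 < L)%N), false);
    rewrite ?inE /=; lia.
- move=> c c'; rewrite !inE => cj c'j e.
  have [row|[row [col0 col0']]] : c.2 = c'.2 /\ adj c c' \/
      c.2 = ~~ c'.2 /\ c.1 = 0%N :> nat /\ c'.1 = 0%N :> nat.
  + case: c c' cj c'j e => [[i iL] b] [[i' iL'] b']; rewrite /adj /= -val_eqE /=.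
    by case: b b' => -[] /= *; [left|right|right|left]; lia.
  + case: row => row a; split=> //; first exact: trivial_horizontal.
    by apply: trivial_horizontal; rewrite // adjC.
  have e1 : c.1 = c'.1 by apply: val_inj; rewrite /= col0.
  case: c c' {cj c'j e} row col0 col0' e1 => [i b] [i' b'] /= -> i0 _ <- {i'}.
  split; first by rewrite /adj /= eqxx; case: b'.
    move=> Z ZL m; rewrite -[b' in X in N _ _ X]negbK.
    by apply: N_flux0; rewrite ?negbK // i0 flux0.
  by move=> Z ZL m; apply: N_flux0; rewrite // i0 flux0.
- apply/setP=> c; rewrite !inE -leqNgt; case: leqP => //= cj.
  exact: XY.
Qed.

(** Splicing [Y] to the left of column [j] with [X] from there on gives [L] particles precisely
    because the fluxes agree; one slide on each side then leads from [X] to [Y]. *)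
Lemma N_flux j X Y : #|X| = L -> #|Y| = L ->
  movable X (j, false) (j, true) -> movable Y (j, false) (j, true) ->
  flux X j = flux Y j -> N X (j, false) (j, true) = N Y (j, false) (j, true).
Proof.
move=> XL YL Xj Yj XYj.
pose Z := [set c in Y | c.1 < j]%N :|: [set c in X | j <= c.1]%N.
have ZX c : (j <= c.1)%N -> (c \in Z) = (c \in X).
  by move=> jc; rewrite !inE jc andbT ltnNge jc andbF.
have ZY c : (c.1 < j)%N -> (c \in Z) = (c \in Y).
  by move=> cj; rewrite !inE cj andbT leqNgt cj andbF orbF.
have ZL : #|Z| = L.
  apply: etrans XL; rewrite -(cardsID [set c : site L | c.1 < j]%N Z).
  rewrite -(cardsID [set c : site L | c.1 < j]%N X); congr (_ + _)%N.
    have -> : Z :&: [set c : site L | c.1 < j]%N = [set c in Y | c.1 < j]%N.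
      by apply/setP=> c; rewrite !inE; case: ltnP; rewrite ?andbF // !andbT orbF.
    have -> : X :&: [set c : site L | c.1 < j]%N = [set c in X | c.1 < j]%N.
      by apply/setP=> c; rewrite !inE.
    by apply/eqP; rewrite -eqz_nat !card_lt_column XYj.
  by apply: eq_card => c; rewrite !inE; case: ltnP; rewrite ?andbF // andbT.
have -> : N X (j, false) (j, true) = N Z (j, false) (j, true).
  by apply: (N_slide_left (j := j)) => // c jc; rewrite ZX.
have Zj : movable Z (j, false) (j, true) by move: Xj; rewrite /movable !ZX.
apply: (N_slide_right (j := j)) => // -[i b] /=; rewrite leq_eqVlt => /orP[/eqP/val_inj->|ij].
  case/and3P: Yj Zj => y0 /negbTE y1 _ /and3P[z0 /negbTE z1 _].
  by case: b; rewrite ?y0 ?y1.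
exact: ZY.
Qed.

End Rigidity.

(** The walk from 0 to [m] by unit steps that then rests at [m]; flux profiles are sums of shifted
    copies. *)
Definition clamp (m : int) (c : nat) : int := (Num.sg m * (minn c `|m|)%:Z)%R.

Lemma clamp0 m : clamp m 0 = 0%R.
Proof. by rewrite /clamp min0n mulr0. Qed.

Lemma clamp_full m c : (`|m| <= c)%N -> clamp m c = m.
Proof. by move=> /minn_idPr mc; rewrite /clamp mc abszE -numEsg. Qed.

Lemma clampS m c : (`|clamp m c.+1 - clamp m c| = (c < `|m|))%N.
Proof. by rewrite /clamp; case: (sgrP m) => m0; lia. Qed.

(** The flux goes to [k] in [|k|] columns, rests there, and returns to 0 in the last [|k|] columns;
    the hypothesis leaves at least one column of rest. *)
Lemma config_one L (k : int) : (`|k|.*2 < L)%N -> exists X : {set site L},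
  #|X| = L /\ forall j : 'I_L, (`|k| <= j)%N -> (j + `|k| < L)%N ->
    flux X j = k /\ movable X (j, false) (j, true).
Proof.
move=> kL; pose F c := (clamp k c - clamp k (c - (L - `|k|)))%R.
have F0 : F 0%N = 0%R by rewrite /F sub0n !clamp0.
have FL : F L = 0%R by rewrite /F !clamp_full; lia.
have FS c : (c < L)%N -> (`|F c.+1 - F c| <= 1)%N.
  move=> cL; have := clampS k c; have := clampS k (c - (L - `|k|)).
  rewrite /F; have [ck|kc] := leqP c.+1 (L - `|k|).
    by rewrite (eqnP ck) (eqnP (ltnW ck)) clamp0; case: (_ < _)%N => /=; lia.
  by rewrite subSn //; case: ltnP => ? /=; case: ltnP => ? /=; lia.
have [X [XL XF XT]] := config_exists F0 FL FS.
exists X; split=> // j kj jk.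
have Fj c : (`|k| <= c)%N -> (c + `|k| <= L)%N -> F c = k.
  move=> kc ck; rewrite /F clamp_full // (_ : (c - _)%N = 0%N) ?clamp0 ?subr0 //.
  by lia.
rewrite XF ?Fj //; [split=> // | lia | lia].
have [|jX jnX] := XT j; first by rewrite !Fj; lia.
by rewrite (movable_vertical _ _ false) jX.
Qed.

(** The flux goes from 0 to [m], rests for one column, goes on to [n], rests for one column, and
    returns to 0. *)
Lemma config_two L (m n : int) : RL L m n -> exists (X : {set site L}) (j j' : 'I_L),
  [/\ #|X| = L, j != j', flux X j = m /\ movable X (j, false) (j, true)
    & flux X j' = n /\ movable X (j', false) (j', true)].
Proof.
rewrite /RL => mn; pose a := `|m|%N; pose b := `|n - m|%N.
(* The largest of [|m|], [|n|], [|n - m|] is the sum of the other two, so the profile has length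
   twice the maximum plus 2, which is at most [L] exactly under [RL]. *)
have abL : (a + b + `|n| + 2 <= L)%N by rewrite /a /b; lia.
pose F c := (clamp m c + clamp (n - m) (c - a.+1) - clamp n (c - (a + b).+2))%R.
have F0 : F 0%N = 0%R by rewrite /F !sub0n !clamp0.
have FL : F L = 0%R by rewrite /F !clamp_full; rewrite /a /b; lia.
have cS k e c : (`|clamp k (c.+1 - e) - clamp k (c - e)|%N = (e <= c < e + `|k|))%N.
  have [ce|ec] := leqP c.+1 e.
    by rewrite (eqnP ce) (eqnP (ltnW ce)) subrr leqNgt ce.
  by rewrite subSn // clampS; congr nat_of_bool; lia.
have FS c : (c < L)%N -> (`|F c.+1 - F c| <= 1)%N.
  move=> _; have := clampS m c; have := cS (n - m)%R a.+1 c.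
  have := cS n (a + b).+2 c; rewrite /F -/a -/b; clear.
  case: (ltnP c a) => h1; case: (boolP (a.+1 <= c < _)%N) => h2;
    by case: (boolP ((a + b).+2 <= c < _)%N) => h3; clear -h1 h2 h3; lia.
have [X [XL XF XT]] := config_exists F0 FL FS.
have jL : (a < L)%N by lia.
have jL' : ((a + b).+1 < L)%N by lia.
exists X, (Ordinal jL), (Ordinal jL'); split=> //.
- by rewrite -val_eqE /=; lia.
- have Fm c : (a <= c <= a.+1)%N -> F c = m.
    move=> ac; rewrite /F clamp_full; last by rewrite -/a; lia.
    have -> : (c - a.+1 = 0)%N by lia.
    have -> : (c - (a + b).+2 = 0)%N by lia.
    by rewrite !clamp0 addr0 subr0.
  have [|jX jnX] := XT (Ordinal jL); first by rewrite !Fm //=; lia.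
  by rewrite XF ?Fm //= ?(movable_vertical _ _ false) ?jX //; lia.
- have Fn c : ((a + b).+1 <= c <= (a + b).+2)%N -> F c = n.
    move=> ac; rewrite /F (@clamp_full m) ?(@clamp_full (n - m)%R); try by rewrite -/a -/b; lia.
    have -> : (c - (a + b).+2 = 0)%N by lia.
    by rewrite clamp0; lia.
  have [|jX jnX] := XT (Ordinal jL'); first by rewrite !Fn //=; lia.
  by rewrite XF ?Fn //= ?(movable_vertical _ _ false) ?jX //; lia.
Qed.

(** The flux starts and ends at 0, changes by at most 1 per column, and is constant across column
    [j]. *)
Lemma flux_movable_bound L (X : {set site L}) (j : 'I_L) b : #|X| = L ->
  movable X (j, b) (j, ~~ b) -> (`|flux X j| <= j)%N /\ (j + `|flux X j| < L)%N.
Proof.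
move=> XL Xj; split; first exact: flux_le.
have := flux_lip X j.+1 (L - j.+1); rewrite (flux_vertical Xj) subnKC //.
by have := ltn_ord j; rewrite flux_full XL subrr; lia.
Qed.

(** * Independence of the column *)

Section Generators.
Variables (L : nat) (H : groupType) (N : {set site L} -> site L -> site L -> H).
Implicit Types (X Y : {set site L}) (s t c : site L) (i j : 'I_L) (b : bool).
Hypothesis flatN : flat N.
Hypothesis N_path : forall X s t, #|X| = L -> movable X s t ->
  pos s = (pos t).+1 \/ pos t = (pos s).+1 -> N X s t = 1.

(** [W] has the given flux at both columns and a single bottom particle in each. Once the one in
    column [j'] is raised, the two particles can rotate around the square: up in [j] and down in
    [j'] equals two horizontal moves, hence is trivial. *)
Lemma N_next j j' X Y : j.+1 = j' :> nat -> #|X| = L -> #|Y| = L ->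
  movable X (j, false) (j, true) -> movable Y (j', false) (j', true) ->
  flux X j = flux Y j' ->
  N X (j, false) (j, true) = N Y (j', false) (j', true).
Proof.
move=> jj' XL YL Xj Yj' XY.
have [kj _] := @flux_movable_bound _ X j false XL Xj.
have [_ kj'] := @flux_movable_bound _ Y j' false YL Yj'.
have [W [WL WP]] : exists W : {set site L},
    #|W| = L /\ forall i, (`|flux X j| <= i)%N -> (i + `|flux X j| < L)%N ->
    flux W i = flux X j /\ movable W (i, false) (i, true).
  by apply: config_one; move: kj kj'; rewrite -XY; lia.
have [WXj Wj] : flux W j = flux X j /\ movable W (j, false) (j, true).
  by apply: WP => //; move: kj'; rewrite -XY; lia.
have [WXj' Wj'] : flux W j' = flux X j /\ movable W (j', false) (j', true).
  by apply: WP => //; [lia | rewrite XY].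
have jnj' : (j == j') = false by rewrite -val_eqE /=; lia.
have ne (b b' : bool) : (j, b) != (j', b') by rewrite xpair_eqE jnj'.
have ne' (b b' : bool) : (j', b') != (j, b) by rewrite eq_sym.
pose V := mv W (j', false) (j', true).
have VL : #|V| = L by case/and3P: Wj' => ? ? _; rewrite card_mv.
have Vj : movable V (j, false) (j, true) by apply: movable_mv2.
have Vj' : movable V (j', true) (j', false) by apply: movable_mv.
have := (Vj, Vj') => -[/and3P[v1 v2 _] /and3P[v3 v4 _]].
have h1 : adj (j, false) (j', false) by rewrite /adj /= jj' eqxx orbT.
have h2 : adj (j', true) (j, true) by rewrite adjC /adj /= jj' eqxx orbT.
have m1 : movable V (j, false) (j', false) by rewrite /movable v1 v4.
have m2 : movable V (j', true) (j, true) by rewrite /movable v3 v2.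
have := flatN => -[F1 _ F3].
have := F3 _ _ _ _ _ VL Vj m1 m2 Vj' (ne _ _) (ne _ _).
rewrite (trivial_horizontal N_path _ h1) // (trivial_horizontal N_path _ h2) //; last first.
- exact: movable_mv2.
- by rewrite card_mv.
pose U := mv V (j, false) (j, true).
have UL : #|U| = L by rewrite card_mv.
have Uj' : movable U (j', true) (j', false) by apply: movable_mv2.
have := (Uj') => /and3P[u1 u2 _].
pose U' := mv U (j', true) (j', false).
have U'j' : movable U' (j', false) (j', true) by apply: movable_mv.
have U'L : #|U'| = L by rewrite card_mv.
have -> : N U (j', true) (j', false) = (N U' (j', false) (j', true))^-1.
  by rewrite -F1 // /U' mvK.
have fV : flux V =1 flux W by apply: (flux_mv_vertical (b := false)); case/and3P: Wj'.
have fU : flux U =1 flux V by apply: (flux_mv_vertical (b := false)).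
have fU' : flux U' =1 flux U by apply: (flux_mv_vertical (b := true)).
rewrite (N_flux flatN N_path (X := V) (Y := X)) ?fV //.
rewrite (N_flux flatN N_path (X := U') (Y := Y)) ?fU' ?fU ?fV ?WXj' //.
by rewrite mulg1 => /divg1_eq.
Qed.

Lemma N_flux_indep j j' X Y : #|X| = L -> #|Y| = L ->
  movable X (j, false) (j, true) -> movable Y (j', false) (j', true) ->
  flux X j = flux Y j' ->
  N X (j, false) (j, true) = N Y (j', false) (j', true).
Proof.
wlog jj' : j j' X Y / (j <= j')%N => [wl|].
  case: (leqP j j') => [|/ltnW] jj' *; first exact: wl.
  by apply/esym/wl.
move=> XL YL Xj Yj' XY.
have [d] := ubnP (j' - j)%N; elim: d j X jj' XL Xj XY => [|d IHd] j X jj' XL Xj XY jd.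
  by rewrite ltn0 in jd.
have [e|ne] := eqVneq j j'; first by move: Yj' XY; rewrite -e; exact: N_flux.
have lt : (j < j')%N by rewrite ltn_neqAle jj' andbT.
have jL : (j.+1 < L)%N by apply: leq_ltn_trans lt _.
have [kj _] := @flux_movable_bound _ X j false XL Xj.
have [_ kj'] := @flux_movable_bound _ Y j' false YL Yj'.
have [W [WL WP]] : exists W : {set site L},
    #|W| = L /\ forall i, (`|flux X j| <= i)%N -> (i + `|flux X j| < L)%N ->
    flux W i = flux X j /\ movable W (i, false) (i, true).
  by apply: config_one; move: kj kj'; rewrite -XY; lia.
have [Wf Wm] : flux W (Ordinal jL) = flux X j /\
    movable W (Ordinal jL, false) (Ordinal jL, true).
  by apply: WP => /=; move: kj kj'; rewrite -XY; lia.
rewrite (N_next (j' := Ordinal jL) (Y := W)) //.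
apply: IHd => //; [by rewrite Wf | by move: jd lt; clear; rewrite /=; lia].
Qed.

End Generators.

(** * Classification of flat connections *)

Definition step_value L (H : groupType) (A : int -> H) (X : {set site L}) (s t : site L) : H :=
  if s.1 == t.1 then (if s.2 then (A (flux X s.1))^-1 else A (flux X s.1)) else 1.

Theorem flat_classification L (H : groupType) (N : {set site L} -> site L -> site L -> H) :
  flat N ->
  exists (h : {set site L} -> H) (A : int -> H),
    [/\ A 0%R = 1, forall m n, RL L m n -> commute (A m) (A n)
      & forall (X : {set site L}) s t, #|X| = L -> movable X s t ->
          N X s t = h X * step_value A X s t * (h (mv X s t))^-1].
Proof.
move=> flatN; have [h hP] := flat_trivialize flatN.
have flatG := flat_gauge h flatN; move: hP flatG.
set G := gauge N h => hP flatG.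
have /choice[A AP] : forall k : int, exists a : H, (k = 0%R -> a = 1) /\
    forall (X : {set site L}) (j : 'I_L), #|X| = L -> movable X (j, false) (j, true) ->
      flux X j = k -> G X (j, false) (j, true) = a.
  move=> k.
  have [->|k0] := eqVneq k 0%R.
    by exists 1; split=> // X j XL Xj Xf; apply: (N_flux0 flatG hP (b := false)).
  have [[X [j [XL Xj Xf]]]|none] := pselect (exists (X : {set site L}) (j : 'I_L),
      [/\ #|X| = L, movable X (j, false) (j, true) & flux X j = k]).
    exists (G X (j, false) (j, true)); split=> [e|Y i YL Yi Yf].
      by rewrite e eqxx in k0.
    by apply: (N_flux_indep flatG hP); rewrite // Yf Xf.
  (* No vertical move has flux [k], so any value will do. *)
  exists 1; split=> // X j XL Xj Xf; case: none; by exists X, j.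
exists h, A; split; first by case: (AP 0%R) => ->.
- move=> m n /config_two[X [j [j' [XL jj' [fj Xj] [fj' Xj']]]]].
  have ne (b b' : bool) : (j, b) != (j', b') by rewrite xpair_eqE (negbTE jj').
  have ne' (b b' : bool) : (j', b') != (j, b) by rewrite eq_sym.
  have := (Xj, Xj') => -[/and3P[x1 x2 _] /and3P[x3 x4 _]].
  (* A vertical move changes no flux, so the opposite sides of this commutation square carry the
     same generator. *)
  case: flatG => _ F2 _; have := F2 _ _ _ _ _ XL Xj Xj' (ne _ _) (ne _ _).
  have [_ Am] := AP m; have [_ An] := AP n.
  have M1 := movable_mv2 Xj Xj' (ne _ _) (ne _ _).
  have M2 := movable_mv2 Xj' Xj (ne' _ _) (ne' _ _).
  rewrite (Am X j) // (An X j') // (An _ j' _ M1) ?(Am _ j _ M2) //.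
  all: rewrite ?card_mv ?(flux_mv_vertical (b := false)) //.
- move=> X s t XL st; have e : N X s t = h X * G X s t * (h (mv X s t))^-1.
    by rewrite /G /gauge !mulgA mulgV mul1g mulgK.
  rewrite e; congr (_ * _ * _); rewrite /step_value.
  have [st1|st1] := eqVneq s.1 t.1; last first.
    apply: (trivial_horizontal hP) => //; first by
      case/and3P: st => _ _ /orP[]/andP[]; [rewrite (negbTE st1) | move/eqP].
    by case/and3P: st.
  case: s t st1 st {e} => [j b] [j' b'] /= <- st.
  have bb' : b' = ~~ b.
    case/and3P: st => _ _; rewrite /adj /= eqxx /= gtn_eqF // orbF andbF orbF.
    by case: b b' => -[].
  subst b'.
  case: b st => /= st; last by have [_] := AP (flux X j); apply.
  case/and3P: (st) => x1 x2 _; have [_ Aj] := AP (flux X j).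
  have st' := movable_mv st.
  case: flatG => F1 _ _; rewrite -(Aj (mv X (j, true) (j, false)) j) //.
  + by rewrite F1 // invgK.
  + by rewrite card_mv.
  + by rewrite (flux_mv_vertical (b := true)).
Qed.

(** * Plugs as configurations *)

Section Geometry.
Variable L : nat.
Local Notation D := (rectangle2 L).
Implicit Types (c s t : site L) (i j : 'I_L) (A B d : {set D}) (T : {set {set D}}).

Lemma site_in_rectangle c : ((c.1 : nat)%:Z, (c.2 : nat)%:Z)%R \in D.
Proof.
apply/imfset2P; exists (val c.1); first by rewrite mem_iota /=.
by exists (nat_of_bool c.2); rewrite // mem_iota; case: c.2.
Qed.

Definition sq c : D := FSetSub (site_in_rectangle c).

Lemma sq_inj : injective sq.
Proof.
move=> [i b] [i' b'] /(congr1 val) /= [/val_inj -> bb'].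
by case: b b' bb' => -[].
Qed.

Lemma sq_surj (x : D) : exists c, sq c == x.
Proof.
case: x => x xD; have /imfset2P[i /= iL [j /= jB xE]] := xD.
have iL' : (i < L)%N by have := mem_iota 0 L i; rewrite iL.
exists (Ordinal iL', j == 1)%N; rewrite -val_eqE /= xE.
by case: j jB xE => [|[|j]].
Qed.

Definition unsq (x : D) : site L := xchoose (sq_surj x).

Lemma unsqK : cancel unsq sq.
Proof. by move=> x; apply/eqP/(xchooseP (sq_surj x)). Qed.

Lemma sqK : cancel sq unsq.
Proof. by move=> c; apply: sq_inj; rewrite unsqK. Qed.

Definition black c := odd (c.1 + c.2).

Lemma white_sq c : white (val (sq c)) = ~~ black c.
Proof. by rewrite /white /black /= -PoszD -dvdn2. Qed.

Lemma adjacent_sq s t : adjacent (val (sq s)) (val (sq t)) = adj s t.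
Proof.
case: s t => [i b] [i' b']; rewrite /adjacent /adj /= -val_eqE /=.
by case: b b' => -[] /=; lia.
Qed.

Definition dom s t : {set D} := [set sq s; sq t].

Lemma domC s t : dom s t = dom t s.
Proof. exact: setUC. Qed.

Lemma dominoP d : reflect (exists s t, adj s t /\ d = dom s t) (domino d).
Proof.
apply: (iffP existsP) => [[x /existsP[y /andP[xy /eqP->]]]|[s [t [st ->]]]].
  by exists (unsq x), (unsq y); rewrite -adjacent_sq /dom !unsqK.
by exists (sq s); apply/existsP; exists (sq t); rewrite adjacent_sq st /dom /=.
Qed.

Lemma adj_black s t : adj s t -> black t = ~~ black s.
Proof.
by case: s t => [i b] [i' b']; rewrite /adj /black -val_eqE /=; case: b b' => -[] /=; lia.
Qed.

Lemma domino_blackP d : domino d -> exists s t, [/\ adj s t, black s & d = dom s t].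
Proof.
case/dominoP=> s [t [st ->]]; have := adj_black st.
by case: (boolP (black s)) => bs bt; [exists s, t | exists t, s]; rewrite // adjC bt domC.
Qed.

Definition vdom j : {set D} := dom (j, false) (j, true).

Lemma sq_dom s t c : (sq c \in dom s t) = (c == s) || (c == t).
Proof. by rewrite !inE !(inj_eq sq_inj). Qed.

Lemma sq_vdom j c : (sq c \in vdom j) = (c.1 == j).
Proof. by case: c => i []; rewrite sq_dom !xpair_eqE /= ?andbT ?andbF ?orbF. Qed.

Lemma vdom_inj : injective vdom.
Proof.
by move=> i j ij; apply/eqP; rewrite -[i]/((i, true).1) -sq_vdom -ij sq_vdom.
Qed.

(* Site [c] carries a particle iff it is white and filled, or black and empty,
   so that adding a domino to a plug moves one particle from a black site to a
   white one. *)
Definition particles A : {set site L} := [set c | (sq c \in A) (+) black c].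

Definition filling (X : {set site L}) : {set D} := [set x | (unsq x \in X) (+) black (unsq x)].

Lemma particlesK : cancel particles filling.
Proof. by move=> A; apply/setP=> x; rewrite !inE unsqK addbK. Qed.

Lemma fillingK : cancel filling particles.
Proof. by move=> X; apply/setP=> c; rewrite !inE sqK addbK. Qed.

(** Complementing a plug exchanges particles and holes, and a column has two sites. *)
Lemma flux_particlesC A j : (j <= L)%N ->
  (flux (particles (~: A)) j = - flux (particles A) j)%R.
Proof.
rewrite /flux => jL; rewrite -sumrN; apply: eq_bigr => i _.
have iL : (i < L)%N by apply: leq_trans jL.
rewrite -[val i]/(val (Ordinal iL)) !card_column !inE.
by do 2![case: (sq _ \in A)]; do 2![case: (black _)]; lia.
Qed.

Lemma card_sq (P : pred D) : #|[set x | P x]| = (\sum_i (P (sq (i, false)) + P (sq (i, true))))%N.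
Proof.
rewrite -sum1dep_card big_mkcond (reindex sq) /=; last first.
  by exists unsq => x _; [apply: sqK | apply: unsqK].
rewrite (eq_bigr (fun c : site L => P (sq (c.1, c.2)) : nat)); last by case=> i b _ /=; case: (P _).
rewrite -(pair_bigA _ (fun i b => P (sq (i, b)) : nat)) /=.
by apply: eq_bigr => i _; rewrite big_bool addnC.
Qed.

(** Every column contains exactly one black square, so there are [L] of them. *)
Lemma card_particles A :
  (#|particles A| + #|[set x in A | ~~ white (val x)]| = L + #|[set x in A | white (val x)]|)%N.
Proof.
have -> : #|particles A| = #|[set x | (x \in A) (+) black (unsq x)]|.
  rewrite -(card_imset _ sq_inj); apply: eq_card => x.
  by rewrite -(unsqK x) (mem_imset _ _ sq_inj) !inE sqK.
rewrite !card_sq -big_split -[X in (X + _)%N]card_ord -sum1_card -big_split /=.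
apply: eq_bigr => i _; rewrite !sqK.
move: (white_sq (i, false)) (white_sq (i, true)) => /= -> ->.
rewrite /black /= addn0 addn1 /= !negbK.
by do 2![case: (sq _ \in A)]; case: (odd i).
Qed.

Lemma balanced_particles A : balanced A = (#|particles A| == L).
Proof.
rewrite /balanced; have := card_particles A.
move: (#|particles A|) #|_| #|_| => n w b nb.
by apply/eqP/eqP; lia.
Qed.

End Geometry.

(** The product is taken in the enumeration order of [I], as [H] need not be commutative. *)
Lemma prodgD1_commute (H : groupType) (I : finType) (P : pred I) (F : I -> H) j :
  P j -> (forall i, P i -> commute (F j) (F i)) ->
  \prod_(i | P i) F i = F j * \prod_(i | P i && (i != j)) F i.
Proof.
move=> Pj comm.
have [r1 [r2 [rE j1 j2]]] : exists r1 r2 : seq I,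
    [/\ index_enum I = r1 ++ j :: r2, j \notin r1 & j \notin r2].
  have jI := mem_index_enum j; have uI := index_enum_uniq I.
  case/splitPr: jI uI => r1 r2; rewrite cat_uniq /= => /and3P[_ /norP[j1 _] /andP[j2 _]].
  by exists r1, r2.
rewrite rE !big_cat !big_cons Pj eqxx /=.
have drop r : j \notin r -> \prod_(i <- r | P i && (i != j)) F i = \prod_(i <- r | P i) F i.
  move=> jr; rewrite big_seq_cond [RHS]big_seq_cond; apply: eq_bigl => i.
  by have [->|_] := eqVneq i j; rewrite ?(negbTE jr) // andbT.
rewrite !drop //; rewrite !mulgA; congr (_ * _).
by apply/esym/commute_prod => i /comm.
Qed.

Lemma prodgV_commute (H : groupType) (I : Type) (r : seq I) (P : pred I) (F : I -> H) :
  (forall i j, P i -> P j -> commute (F i) (F j)) ->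
  \prod_(i <- r | P i) (F i)^-1 = (\prod_(i <- r | P i) F i)^-1.
Proof.
move=> comm; elim: r => [|j r IHr]; first by rewrite !big_nil invg1.
rewrite !big_cons IHr; case: ifP => // Pj; rewrite invgM.
apply: commuteV; apply/commute_sym/commuteV.
by apply/commute_sym/commute_prod => i Pi; apply: comm.
Qed.

(** * Dominoes as moves and floors as sets of moves *)

Section Dominoes.
Variable L : nat.
Local Notation D := (rectangle2 L).
Implicit Types (c s t : site L) (i j : 'I_L) (A B d : {set D}) (T : {set {set D}}).
Implicit Type X : {set site L}.

Lemma add_domino A s t : adj s t -> black s -> [disjoint A & dom s t] ->
  movable (particles A) s t /\ particles (A :|: dom s t) = mv (particles A) s t.
Proof.
move=> st bs dA; have bt := adj_black st.
have sA : sq s \notin A.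
  by move: dA; rewrite disjoint_sym => /disjointFr->; rewrite // sq_dom eqxx.
have tA : sq t \notin A.
  by move: dA; rewrite disjoint_sym => /disjointFr->; rewrite // sq_dom eqxx orbT.
split; first by rewrite /movable st !inE (negbTE sA) (negbTE tA) bt bs.
apply/setP=> c; rewrite in_mv inE in_setU sq_dom [in RHS]inE.
have [->|cs] := eqVneq c s; first by rewrite bs orbT (negbTE (adj_neq st)).
by have [->|ct] := eqVneq c t; rewrite /= ?orbT ?orbF // bt bs.
Qed.

Lemma movable_filling X s t : black s -> movable X s t -> [disjoint filling X & dom s t].
Proof.
move=> bs /and3P[sX tX st]; have bt := adj_black st.
rewrite disjoint_sym disjoints_subset; apply/subsetP=> x.
rewrite !inE => /orP[] /eqP->; rewrite sqK.
  by rewrite sX bs.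
by rewrite (negbTE tX) bt bs.
Qed.

Lemma filling_mv X s t : black s -> movable X s t ->
  filling (mv X s t) = filling X :|: dom s t.
Proof.
move=> bs Xst; have dX := movable_filling bs Xst.
case/and3P: Xst => sX tX st; have [_ e] := add_domino st bs dX.
by rewrite -[RHS]particlesK e fillingK.
Qed.

Lemma flux_mv X s t (j : nat) : adj s t -> s \in X -> t \notin X ->
  (s.1 == j :> nat) = (t.1 == j :> nat) -> flux (mv X s t) j = flux X j.
Proof.
move=> st sX tX stj.
have lt : (s.1 < j)%N = (t.1 < j)%N.
  by move: st stj; rewrite /adj -val_eqE /=; case: (s.2); case: (t.2) => /=; lia.
suff : #|[set c in mv X s t | (c.1 < j)%N]| = #|[set c in X | (c.1 < j)%N]|.
  by move/(congr1 Posz); rewrite !card_lt_column => /addIr.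
have [tj|jt] := boolP (t.1 < j)%N.
  rewrite (_ : [set c in mv X s t | _] = mv [set c in X | (c.1 < j)%N] s t).
    by rewrite card_mv // !inE ?sX ?lt // (negbTE tX).
  apply/setP=> c; rewrite !inE.
  by have [->|] //= := eqVneq c t; rewrite andbA.
apply: eq_card => c; rewrite !inE.
have [->|ct] := eqVneq c t; first by rewrite (negbTE jt) !andbF.
by have [->|//] := eqVneq c s; rewrite lt (negbTE jt) !andbF.
Qed.

(** A floor seen from its source alone: the target is forced to be what [A] and [T] leave uncovered.
    This form survives adding dominoes to [A] one by one. *)
Definition packed A T :=
  [/\ trivIset T, {in T, forall d, domino d} & [disjoint A & cover T]].

Lemma cover_add d T : cover (d |: T) = d :|: cover T.
Proof.
apply/setP=> x; rewrite inE; apply/bigcupP/orP=> [[B]|[xd|/bigcupP[B BT xB]]].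
- by rewrite !inE => /orP[/eqP->|BT] xB; [left | right; apply/bigcupP; exists B].
- by exists d; rewrite ?setU11.
- by exists B; rewrite // setU1r.
Qed.

Lemma cover0 : cover (set0 : {set {set D}}) = set0.
Proof. by rewrite /cover big_set0. Qed.

Lemma cover_set1 d : cover [set d] = d.
Proof. by rewrite /cover big_set1. Qed.

Lemma packed0 A : packed A set0.
Proof.
split; first by apply/trivIsetP => B C; rewrite inE.
  by move=> d; rewrite inE.
by rewrite cover0 disjoint_sym disjoints_subset sub0set.
Qed.

Lemma packed1 A d : domino d -> [disjoint A & d] -> packed A [set d].
Proof.
move=> dd Ad; split; rewrite ?cover_set1 //; last by move=> B; rewrite inE => /eqP->.
by apply/trivIsetP=> B C; rewrite !inE => /eqP-> /eqP->; rewrite eqxx.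
Qed.

Lemma packed_add A d T : d \notin T -> packed A (d |: T) ->
  [/\ domino d, [disjoint A & d], packed A [set d] & packed (A :|: d) T].
Proof.
move=> dT [triv dom]; rewrite cover_add => disj.
have dd : domino d by apply: dom; rewrite setU11.
have Ad : [disjoint A & d] by apply: disjointWr disj; apply: subsetUl.
have AT : [disjoint A & cover T] by apply: disjointWr disj; apply: subsetUr.
split=> //; first exact: packed1.
split; first by apply: trivIsetS triv; apply: subsetUr.
  by move=> B BT; apply: dom; rewrite setU1r.
rewrite -setI_eq0 setIUl setU_eq0 !setI_eq0 AT /=.
rewrite disjoints_subset; apply/subsetP=> x xd; rewrite inE; apply/bigcupP => -[B BT xB].
have /trivIsetP/(_ d B) := triv; rewrite setU11 setU1r // => /(_ isT isT).
have dB : d != B by apply: contraNneq dT => ->.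
by move=> /(_ dB) /disjointFr/(_ xd); rewrite xB.
Qed.

Lemma packed_ind (Q : {set D} -> {set {set D}} -> Prop) :
  (forall A, Q A set0) ->
  (forall A d T, d \notin T -> packed A (d |: T) -> Q (A :|: d) T -> Q A (d |: T)) ->
  forall A T, packed A T -> Q A T.
Proof.
move=> Q0 Qadd A T; have [n] := ubnP #|T|; elim: n A T => [|n IHn] A T.
  by rewrite ltn0.
have [->|/set0Pn[d dT]] := eqVneq T set0; first by move=> _ _; apply: Q0.
rewrite -(setD1K dT) => Tn AT; have dT' : d \notin T :\ d by rewrite !inE eqxx.
apply: Qadd => //; apply: IHn; last by have [] := packed_add dT' AT.
by move: Tn; rewrite cardsU1 dT' ltnS.
Qed.

(** No particle crosses the left side of column [j]: the domino lies inside that column or does not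
    meet it. Hence all fluxes of a floor can be read at its source plug. *)
Lemma flux_add A d j : domino d -> [disjoint A & d] ->
  d = vdom j \/ [disjoint d & vdom j] ->
  flux (particles (A :|: d)) j = flux (particles A) j.
Proof.
case/domino_blackP=> s [t [st bs ->]] Ad dj.
have [/and3P[sX tX _] ->] := add_domino st bs Ad.
apply: flux_mv => //; rewrite (val_eqE s.1 j) (val_eqE t.1 j) -!sq_vdom.
case: dj => [<-|dj]; first by rewrite !sq_dom !eqxx orbT.
by rewrite !(disjointFr dj) // sq_dom eqxx ?orbT.
Qed.

Lemma packed_vdom A T j d : packed A T -> vdom j \in T -> d \in T ->
  d = vdom j \/ [disjoint d & vdom j].
Proof.
case=> /trivIsetP triv _ _ jT dT; have [->|dj] := eqVneq d (vdom j); first by left.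
by right; apply: triv.
Qed.

Lemma flux_cover A T j : packed A T -> vdom j \in T ->
  flux (particles (A :|: cover T)) j = flux (particles A) j.
Proof.
move=> AT jT; have dj := fun d => packed_vdom (d := d) AT jT.
move: dj {jT}; move: A T AT; apply: packed_ind => [A|A d T dT AT IH] dj.
  by rewrite cover0 setU0.
have [dd Ad _ _] := packed_add dT AT.
rewrite cover_add setUA IH; last by move=> B BT; apply: dj; rewrite setU1r.
by apply: flux_add => //; apply: dj; rewrite setU11.
Qed.

Lemma disjoint_vdom_movable A j : [disjoint A & vdom j] ->
  movable (particles A) (j, ~~ odd j) (j, odd j).
Proof.
have e : vdom j = dom (j, ~~ odd j) (j, odd j) by case: odd; rewrite // domC.
rewrite e => /add_domino[] //; first by rewrite /adj /= eqxx; case: odd.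
by rewrite /black /= oddD; case: odd.
Qed.

(** Converse of [config_two]: the profile needs [|m|] columns before the first domino, [|n - m|]
    between the two and [|n|] after the second. *)
Lemma packed_RL A T i j : balanced A -> packed A T -> vdom i \in T -> vdom j \in T ->
  i != j -> RL L (flux (particles A) i) (flux (particles A) j).
Proof.
rewrite balanced_particles => /eqP; set X := particles A => XL AT.
have mov k : vdom k \in T -> movable X (k, ~~ odd k) (k, ~~ ~~ odd k).
  move=> kT; rewrite negbK; apply: disjoint_vdom_movable.
  by case: AT => _ _; apply: disjointWr; apply: (bigcup_sup (vdom k)).
wlog ij : i j / (i < j)%N => [wl|iT jT _].
  move=> iT jT; rewrite neq_ltn => /orP[] ij; first by apply: wl; rewrite // neq_ltn ij.
  have := wl j i ij jT iT; rewrite neq_ltn ij => /(_ isT).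
  by rewrite /RL; clear; lia.
have [b1 _] := flux_movable_bound XL (mov _ iT).
have [_ b2] := flux_movable_bound XL (mov _ jT).
have := flux_lip X i.+1 (j - i.+1); rewrite (flux_vertical (mov _ iT)) subnKC //.
by rewrite /RL; move: b1 b2 ij (ltn_ord j); clear; lia.
Qed.

End Dominoes.

(** * Holonomy of walks *)

Section Holonomy.
Variables (L : nat) (H : groupType) (A : int -> H).
Hypothesis AC : forall m n, RL L m n -> commute (A m) (A n).
Local Notation D := (rectangle2 L).
Implicit Types (c s t : site L) (i j : 'I_L) (p q d : {set D}) (T : {set {set D}}) (b : bool).

Definition signed b (x : H) : H := if b then x else x^-1.
Definition flip_sign b (k : int) : int := if b then (- k)%R else k.

(** Adding a domino in column [j] moves the particle upwards iff its bottom square is black, that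
    is, iff [j] is odd. At odd height the configuration is read off the complementary plug, so the
    flux changes sign and the domino is removed instead of added. *)
Definition vdom_value b p j : H :=
  signed (odd j (+) b) (A (flip_sign b (flux (particles p) j))).

(* [b] is the parity of the height of the floor [T] above the plug [p]. *)
Definition floor_value b p T : H := \prod_(j | vdom j \in T) vdom_value b p j.

Lemma commute_signed b b' (x y : H) : commute x y -> commute (signed b x) (signed b' y).
Proof.
move=> xy; have xy' := commuteV xy.
by case: b; case: b' => //=; apply/commute_sym => //; apply/commuteV/commute_sym.
Qed.

Lemma vdom_value_commute b p T i j : balanced p -> packed p T ->
  vdom i \in T -> vdom j \in T -> commute (vdom_value b p i) (vdom_value b p j).
Proof.
move=> bp pT iT jT; have [->//|ij] := eqVneq i j; apply/commute_signed/AC.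
have := packed_RL bp pT iT jT ij.
by rewrite /RL; case: b => //=; clear; lia.
Qed.

Lemma floor_value0 b p : floor_value b p set0 = 1.
Proof. by rewrite /floor_value big1 // => j; rewrite inE. Qed.

Lemma floor_value1 b p j : floor_value b p [set vdom j] = vdom_value b p j.
Proof.
by rewrite /floor_value (big_pred1 j) // => i; rewrite inE (inj_eq (@vdom_inj L)).
Qed.

Lemma floor_value_horizontal b p d : (forall j, d != vdom j) -> floor_value b p [set d] = 1.
Proof. by move=> dV; rewrite /floor_value big1 // => j; rewrite inE eq_sym (negbTE (dV j)). Qed.

Lemma floor_value_add b p d T : balanced p -> d \notin T -> packed p (d |: T) ->
  floor_value b p (d |: T) = floor_value b p [set d] * floor_value b (p :|: d) T.
Proof.
move=> bp dT pT; have [dd pd _ _] := packed_add dT pT.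
have -> : floor_value b (p :|: d) T = \prod_(j | vdom j \in T) vdom_value b p j.
  apply: eq_bigr => j jT; rewrite /vdom_value flux_add //.
  by apply: (packed_vdom pT); rewrite ?setU11 ?setU1r.
have [/existsP[i /eqP di]|/existsPn dV] := boolP [exists i, d == vdom i]; last first.
  rewrite floor_value_horizontal // mul1g; apply: eq_bigl => j.
  by rewrite !inE eq_sym (negbTE (dV j)).
rewrite {2}di floor_value1 /floor_value (prodgD1_commute (j := i)) ?di ?setU11 //.
  congr (_ * _); apply: eq_bigl => j; rewrite !inE (inj_eq (@vdom_inj L)).
  by case: eqVneq => [->|] /=; rewrite ?andbT // -di (negbTE dT).
by rewrite -di => j jT; apply: (vdom_value_commute _ bp pT); rewrite // -di setU11.
Qed.

(** The flux is negated once by the complement and once by the change of parity, so only the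
    exponents are reversed; the order of the factors is immaterial by commutation. *)
Lemma floor_value_compl b p q T : balanced p -> packed p T -> q = ~: (p :|: cover T) ->
  floor_value b q T = (floor_value (~~ b) p T)^-1.
Proof.
move=> bp pT ->; rewrite /floor_value -prodgV_commute; last first.
  by move=> i j iT jT; apply: (vdom_value_commute _ bp pT).
apply: eq_bigr => j jT; rewrite /vdom_value flux_particlesC ?(ltnW (ltn_ord j)) //.
rewrite (flux_cover pT jT).
by rewrite addbN; case: b; case: (odd j) => //=; rewrite ?opprK ?invgK.
Qed.

Definition hdom i i' b : {set D} := dom (i, b) (i', b).

Lemma hdom_neq_vdom i i' j b : i != i' -> hdom i i' b != vdom j.
Proof.
move=> ii'; apply: contraNneq ii' => e.
have := sq_vdom j (i, b); rewrite -e sq_dom eqxx /= => /esym/eqP->.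
by have := sq_vdom j (i', b); rewrite -e sq_dom eqxx orbT /= => /esym/eqP->.
Qed.

(** Vertical dominoes in adjacent columns see the same flux but have opposite exponents, so together
    they are worth as much as two horizontal ones. *)
Lemma floor_value_flip b p T i i' : i.+1 = i' :> nat -> balanced p ->
  hdom i i' false \notin T -> hdom i i' true \notin T ->
  vdom i \notin T -> vdom i' \notin T ->
  packed p (hdom i i' false |: (hdom i i' true |: T)) ->
  packed p (vdom i |: (vdom i' |: T)) ->
  floor_value b p (hdom i i' false |: (hdom i i' true |: T)) =
  floor_value b p (vdom i |: (vdom i' |: T)).
Proof.
move=> ii' bp h1T h2T v1T v2T hT vT.
have ne : i != i' by rewrite -val_eqE /=; lia.
have h1 : hdom i i' false \notin hdom i i' true |: T.
  rewrite in_setU1 (negbTE h1T) orbF; apply/eqP => /setP/(_ (sq (i, false))).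
  by rewrite !sq_dom eqxx !xpair_eqE /= !andbF.
have v1 : vdom i \notin vdom i' |: T.
  by rewrite in_setU1 (negbTE v1T) orbF (inj_eq (@vdom_inj L)).
have [dh1 ph1 _ hT1] := packed_add h1 hT; have [dh2 ph2 _ hT2] := packed_add h2T hT1.
have [dv1 pv1 _ vT1] := packed_add v1 vT; have [dv2 pv2 _ vT2] := packed_add v2T vT1.
have bal q d : domino d -> [disjoint q & d] -> balanced q -> balanced (q :|: d).
  case/domino_blackP=> s [t [st bs ->]] qd; rewrite !balanced_particles.
  by have [/and3P[sq tq _] ->] := add_domino st bs qd; rewrite card_mv.
rewrite floor_value_add // [in LHS]floor_value_add //; last exact: bal.
rewrite !floor_value_horizontal; try by move=> j; apply: hdom_neq_vdom.
rewrite !mul1g [RHS]floor_value_add // [in RHS]floor_value_add //; last exact: bal.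
rewrite !floor_value1 mulgA.
have -> : vdom_value b p i * vdom_value b (p :|: vdom i) i' = 1.
  rewrite /vdom_value flux_add //; last first.
    by apply: (packed_vdom vT); rewrite ?setU11 // setU1r ?setU11.
  have := flux_vertical (b := ~~ odd i); rewrite negbK => fv.
  rewrite -ii' (fv _ _ _ (disjoint_vdom_movable pv1)) /= addNb.
  by case: (_ (+) _); rewrite /= ?mulgV ?mulVg.
rewrite mul1g; congr floor_value; apply/setP=> x.
rewrite -(unsqK x) !inE !(inj_eq (@sq_inj L)); case: (unsq x) => k c.
by rewrite !xpair_eqE; case: (_ \in p) => //=; case: c; case: (k == i); case: (k == i').
Qed.

End Holonomy.

Section WalkHolonomy.
Variables (L : nat) (H : groupType) (A : int -> H).
Hypothesis AC : forall m n, RL L m n -> commute (A m) (A n).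
Local Notation D := (rectangle2 L).
Implicit Types (i j : 'I_L) (p q d : {set D}) (T : {set {set D}}) (b : bool).
Implicit Types (e : domino_dart D) (s t : seq (domino_dart D)).

Lemma flipP T T' : flip T T' -> exists i i', i.+1 = i' :> nat /\
  let Hs := [set hdom i i' false; hdom i i' true] in
  let Vs := [set vdom i; vdom i'] in
  (Hs \subset T /\ T' = (T :\: Hs) :|: Vs) \/ (Vs \subset T /\ T' = (T :\: Vs) :|: Hs).
Proof.
case=> s00 [s10 [s01 [s11]]].
rewrite -(unsqK s00) -(unsqK s10) -(unsqK s01) -(unsqK s11).
case: (unsq s00) (unsq s10) (unsq s01) (unsq s11) => i b [i1 b1] [i2 b2] [i3 b3] /=.
case=> -[e1 e1'] [e2 e2'] [e3 e3'] TT'.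
have b0 : b = false by case: b b2 {e1' e3' TT'} e2' => -[].
have b10 : b1 = false by case: b1 e1' {e3' TT'}; rewrite b0.
have b20 : b2 = true by case: b2 e2' {TT'}; rewrite b0.
have b30 : b3 = true by case: b3 e3' {TT'}; rewrite b0.
have i1E : i1 = i.+1 :> nat by lia.
have i2E : i2 = i by apply: val_inj => /=; lia.
have i3E : i3 = i1 by apply: val_inj => /=; lia.
by exists i, i1; split=> //; move: TT'; rewrite b0 b10 b20 b30 i2E i3E.
Qed.

Lemma floor_value_flips b p T T' : balanced p -> packed p T -> packed p T' -> flip T T' ->
  floor_value A b p T = floor_value A b p T'.
Proof.
move=> bp pT pT' /flipP[i [i' [ii' TT']]].
have ne : i != i' by rewrite -val_eqE /=; lia.
have clash k c : k \in [:: i; i'] -> vdom k \in T -> hdom i i' c \in T -> False.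
  move=> kii' kT hT; case: (packed_vdom pT kT hT) => [e|dj].
    by have := hdom_neq_vdom k c ne; rewrite e eqxx.
  have := disjointFr dj; move/(_ (sq (k, c))).
  rewrite sq_vdom eqxx /hdom sq_dom !xpair_eqE eqxx !andbT.
  by move: kii'; rewrite !inE => -> /(_ isT).
case: TT' => -[sub T'E].
- have h c : hdom i i' c \in T by apply: (subsetP sub); case: c; rewrite !inE eqxx ?orbT.
  have v k : k \in [:: i; i'] -> vdom k \notin T.
    by move=> kk; apply/negP => kT; apply: (clash k true).
  set T0 := T :\: _ in T'E.
  have TE : T = hdom i i' false |: (hdom i i' true |: T0).
    by rewrite setUA setUC -{1}(setID T [set hdom i i' false; hdom i i' true]) setUC (setIidPr sub).
  have T'E' : T' = vdom i |: (vdom i' |: T0) by rewrite T'E setUA setUC.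
  have hT0 c : hdom i i' c \notin T0 by rewrite in_setD; case: c; rewrite !inE eqxx ?orbT.
  have vT0 k : k \in [:: i; i'] -> vdom k \notin T0.
    by move=> kk; rewrite in_setD negb_and v ?orbT.
  rewrite TE T'E'; apply: floor_value_flip; rewrite -?TE -?T'E' ?hT0 ?vT0 //;
    by rewrite !inE eqxx ?orbT.
- have v k : k \in [:: i; i'] -> vdom k \in T.
    by move=> kk; apply: (subsetP sub); move: kk; rewrite !inE => /orP[]/eqP->; rewrite eqxx ?orbT.
  have h c : hdom i i' c \notin T.
    by apply/negP => cT; apply: (clash i c); rewrite ?v // !inE eqxx.
  set T0 := T :\: _ in T'E.
  have TE : T = vdom i |: (vdom i' |: T0).
    by rewrite setUA setUC -{1}(setID T [set vdom i; vdom i']) setUC (setIidPr sub).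
  have T'E' : T' = hdom i i' false |: (hdom i i' true |: T0) by rewrite T'E setUA setUC.
  have hT0 c : hdom i i' c \notin T0 by rewrite in_setD negb_and h ?orbT.
  have vT0 k : k \in [:: i; i'] -> vdom k \notin T0.
    by move=> kk; rewrite in_setD; move: kk; rewrite !inE => /orP[]/eqP->; rewrite eqxx ?orbT.
  rewrite TE T'E'; apply/esym; apply: floor_value_flip; rewrite -?TE -?T'E' ?hT0 ?vT0 //;
    by rewrite !inE eqxx ?orbT.
Qed.

Lemma dart_tiling e :
  [/\ [disjoint val (dsource e) & val (dtarget e)],
      cover (dtiling e) = ~: (val (dsource e) :|: val (dtarget e)),
      trivIset (dtiling e) & {in dtiling e, forall d, domino d}].
Proof.
case: e => [[[[p q] T] b] eP]; have /and3P[dpq /andP[/and3P[/eqP c t _] /forall_inP dT] _] := eP.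
by [].
Qed.

Lemma dart_packed e : packed (val (dsource e)) (dtiling e).
Proof.
case: (dart_tiling e) => pq cT tT dT; split=> //.
by rewrite cT disjoint_sym disjoints_subset setCU subsetIl.
Qed.

Lemma dart_target e : val (dtarget e) = ~: (val (dsource e) :|: cover (dtiling e)).
Proof.
case: (dart_tiling e) => pq -> _ _; apply/setP=> x; rewrite !inE.
by have := disjointFr pq (x := x); case: (_ \in _) (_ \in _) => [] [] // ->.
Qed.

Fixpoint holonomy b s : H :=
  if s is e :: s' then floor_value A b (val (dsource e)) (dtiling e) * holonomy (~~ b) s'
  else 1.

Lemma holonomy_cat b s t :
  holonomy b (s ++ t) = holonomy b s * holonomy (odd (size s) (+) b) t.
Proof.
elim: s b => [|e s IHs] b /=; first by rewrite mul1g.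
by rewrite IHs mulgA addbN -addNb.
Qed.

Lemma floor_value_target b e :
  floor_value A b (val (dtarget e)) (dtiling e) =
  (floor_value A (~~ b) (val (dsource e)) (dtiling e))^-1.
Proof.
apply: floor_value_compl => //; first exact: (valP (dsource e)).
  exact: dart_packed.
exact: dart_target.
Qed.

Lemma floor_value_opp b e :
  floor_value A b (val (dsource (dopp e))) (dtiling (dopp e)) =
  (floor_value A (~~ b) (val (dsource e)) (dtiling e))^-1.
Proof. exact: floor_value_target. Qed.

Lemma holonomy_winv b s :
  holonomy (odd (size s) (+) b) (winv (@dopp D) s) = (holonomy b s)^-1.
Proof.
elim: s b => [|e s IHs] b; first by rewrite /= invg1.
rewrite /winv /= rev_cons -cats1 holonomy_cat size_rev size_map.
have -> : ~~ odd (size s) (+) b = odd (size s) (+) ~~ b by rewrite addNb addbN.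
by rewrite -/(winv _ _) IHs addKb [holonomy _ [:: _]]mulg1 floor_value_opp negbK invgM.
Qed.

Lemma holonomy_attached b s : domino_attached s -> holonomy b s = 1 /\ ~~ odd (size s).
Proof.
case=> {s} [f ff|e1 e2 s12 t12 _ fl|p1 p2 p3 p4 d e1 e2 e3 e4 dd _ p2E
  [s1 t1] [s2 t2] [s3 t3 _] [s4 t4 _] T3 T4]; split=> //=; rewrite mulg1.
- by rewrite {2}ff floor_value_target negbK mulgV.
- rewrite floor_value_opp negbK.
  rewrite (floor_value_flips b (valP (dsource e1)) (dart_packed e1) _ fl) ?s12 ?mulgV //.
  exact: dart_packed.
have dT e : dsource e = p2 -> d \notin dtiling e.
  move=> se; apply/negP => de; case: (dart_packed e) => _ _; rewrite se p2E.
  case/dominoP: dd de => x [y [_ ->]] de dj.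
  have xC : sq x \in cover (dtiling e).
    by apply/bigcupP; exists (dom x y); rewrite // sq_dom eqxx.
  by have := disjointFl dj xC; rewrite in_setU sq_dom eqxx orbT.
have dT1 : d \notin dtiling e1 by apply: (dT (dopp e1)); rewrite -t1.
have dT2 := dT _ s2.
have add e : dsource e = p3 -> forall T, d \notin T -> dtiling e = d |: T ->
    floor_value A (~~ b) (val p3) (d |: T) =
    floor_value A (~~ b) (val p3) [set d] * floor_value A (~~ b) (val p2) T.
  move=> se T dnT eT; rewrite p2E; apply: floor_value_add => //; first exact: (valP p3).
  by have := dart_packed e; rewrite eT se.
(* With [e1] and [e3] read backwards, all four floors start at [p2] or [p3] with the same parity,
   and the value of [d] splits off from both floors at [p3]. *)
have h1 := floor_value_target (~~ b) e1; have h3 := floor_value_target (~~ b) e3.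
rewrite negbK t1 in h1; rewrite negbK t3 T3 in h3.
rewrite -[floor_value _ b _ _]invgK -h1 s2 T3 negbK -[floor_value _ b _ _]invgK -h3 s4 T4.
rewrite (add e4 s4 _ dT1 T4) (add (dopp e3) t3 _ dT2 T3).
by rewrite invgM !mulgA mulgK mulgVK mulVg.
Qed.

Lemma holonomy_expand b s t : expand (@dopp D) (@domino_attached D) s t ->
  holonomy b s = holonomy b t.
Proof.
case=> {s t} [u v e|u v r ar]; rewrite !holonomy_cat.
  by rewrite [holonomy _ [:: e; _]]/= mulg1 floor_value_opp negbK mulgV mul1g.
have [-> _] := holonomy_attached (odd (size u) (+) b) ar.
by have [_ /negbTE->] := holonomy_attached b ar; rewrite mul1g.
Qed.

Lemma holonomy_homotopic b (p q : @closed_walk (domino_complex D) (empty_plug D)) :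
  homotopic p q -> holonomy b (val p) = holonomy b (val q).
Proof.
pose f (r : @closed_walk (domino_complex D) (empty_plug D)) : H := holonomy b (val r).
rewrite -/(f p) -/(f q); apply: eqclos_inv => {p q} p q.
exact: holonomy_expand.
Qed.

End WalkHolonomy.

(** * Flat connections on the domino complex *)

Section Transport.
Variables (L : nat) (H : groupType).
Local Notation D := (rectangle2 L).
Variable g : domino_dart D -> H.
Hypothesis L_gt2 : (2 < L)%N.
Hypothesis g_opp : forall e, g (dopp e) = (g e)^-1.
Hypothesis g_attached : forall s, domino_attached s -> \prod_(e <- s) g e = 1.
Implicit Types (c s t : site L) (i j : 'I_L) (A B d : {set D}) (T : {set {set D}}).
Implicit Types (e : domino_dart D) (X : {set site L}).

Lemma dsource_dopp e : dsource (dopp e) = dtarget e. Proof. by []. Qed.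
Lemma dtarget_dopp e : dtarget (dopp e) = dsource e. Proof. by []. Qed.
Lemma dtiling_dopp e : dtiling (dopp e) = dtiling e. Proof. by []. Qed.
Lemma dflag_dopp e : dflag (dopp e) = (dsource e == dtarget e) (+) dflag e. Proof. by []. Qed.

Definition floor_class A B T : H :=
  if [pick e : domino_dart D | [&& val (dsource e) == A, val (dtarget e) == B,
      dtiling e == T & ~~ dflag e]] is Some e then g e else 1.

(** The two orientations of a loop have equal values because of the disk attached along its square,
    so the flag can be forgotten. *)
Lemma floor_classE e : g e = floor_class (val (dsource e)) (val (dtarget e)) (dtiling e).
Proof.
have main e' : ~~ dflag e' ->
    g e' = floor_class (val (dsource e')) (val (dtarget e')) (dtiling e').
  move=> fe; rewrite /floor_class; case: pickP => [e2|/(_ e')]; last first.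
    by rewrite !eqxx fe.
  case/and4P=> /eqP/val_inj s2 /eqP/val_inj t2 /eqP T2 f2; congr g; apply/esym/val_inj.
  case: e' fe e2 s2 t2 T2 f2 => [[[[p q] T] f] eP] /= + [[[[p2 q2] T2] f2] eP2] /=.
  rewrite /dflag /dsource /dtarget /dtiling /= => /negbTE-> -> -> -> /negbTE->.
  by [].
have [fe|] := boolP (dflag e); last exact: main.
have st : dsource e = dtarget e.
  case: (e) fe => [[[[p q] T] f] eP]; have /and3P[_ _] := eP.
  by rewrite /dflag /dsource /dtarget /= => /implyP pq /pq/eqP.
have := g_attached (AttachLoop st); rewrite !big_cons big_nil mulg1 => /mulg1_eq <-.
have fo : ~~ dflag (dopp e) by rewrite dflag_dopp fe st eqxx.
by rewrite -g_opp (main _ fo) dsource_dopp dtarget_dopp dtiling_dopp st.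
Qed.

Lemma balanced_setC A : balanced (~: A) = balanced A.
Proof.
rewrite !balanced_particles.
have -> : particles (~: A) = ~: particles A by apply/setP=> c; rewrite !inE addNb.
have := cardsC (particles A); rewrite card_prod card_ord card_bool => e.
by apply/eqP/eqP; move: e; clear; lia.
Qed.

Lemma balanced_add A d : domino d -> [disjoint A & d] -> balanced (A :|: d) = balanced A.
Proof.
case/domino_blackP=> s [t [st bs ->]] Ad; rewrite !balanced_particles.
by have [/and3P[sA tA _] ->] := add_domino st bs Ad; rewrite card_mv.
Qed.

Lemma balanced_cover A T : packed A T -> balanced (A :|: cover T) = balanced A.
Proof.
move: A T; apply: packed_ind => [A|A d T dT pT IH]; first by rewrite cover0 setU0.
by have [dd Ad _ _] := packed_add dT pT; rewrite cover_add setUA IH balanced_add.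
Qed.

Lemma domino_neq0 d : domino d -> d != set0.
Proof.
by case/dominoP=> s [t [_ ->]]; apply/set0Pn; exists (sq s); rewrite sq_dom eqxx.
Qed.

Lemma dart_exists A T : balanced A -> packed A T ->
  exists e, [/\ val (dsource e) = A, val (dtarget e) = ~: (A :|: cover T),
    dtiling e = T & dflag e = false].
Proof.
move=> bA pT; have bB : balanced (~: (A :|: cover T)).
  by rewrite balanced_setC balanced_cover.
case: (pT) => tT dT disj.
pose p : plug D := exist (fun A => balanced A) A bA.
pose q : plug D := exist (fun A => balanced A) _ bB.
suff eP : is_domino_dart (p, q, T, false) by exists (exist (fun x => is_domino_dart x) _ eP).
rewrite /is_domino_dart /= andbT; apply/andP; split.
  by rewrite disjoints_subset setCK subsetUl.
apply/andP; split; last by apply/forall_inP.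
rewrite /partition tT /=; apply/andP; split; last first.
  by apply/negP => /dT /domino_neq0; rewrite eqxx.
apply/eqP/setP=> x; rewrite !inE; have := disjointFr disj (x := x).
by case: (_ \in A) (_ \in cover T) => [] [] // ->.
Qed.

Lemma setC_cover A T : packed A T -> ~: (~: (A :|: cover T) :|: cover T) = A.
Proof.
case=> _ _ disj; apply/setP=> x; rewrite !inE; have := disjointFr disj (x := x).
by case: (_ \in A) (_ \in cover T) => [] [] // ->.
Qed.

Lemma packed_setC A T : packed A T -> packed (~: (A :|: cover T)) T.
Proof. by case=> tT dT _; split; rewrite // disjoints_subset setCS subsetUr. Qed.

Lemma floor_class_opp A T : balanced A -> packed A T ->
  floor_class (~: (A :|: cover T)) A T = (floor_class A (~: (A :|: cover T)) T)^-1.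
Proof.
move=> bA pT; have [e [sE tE TE _]] := dart_exists bA pT.
have := floor_classE e; rewrite sE tE TE => <-; rewrite -g_opp floor_classE.
by rewrite dsource_dopp dtarget_dopp dtiling_dopp tE sE TE.
Qed.

(* The class of the path from [A] to [A :|: cover T] through the complement of
   the latter. *)
Definition fill_class A T : H :=
  floor_class A (~: (A :|: cover T)) T *
  floor_class (~: (A :|: cover T)) (A :|: cover T) set0.

Lemma fill_class0 A : balanced A -> fill_class A set0 = 1.
Proof.
move=> bA; have := floor_class_opp bA (packed0 A).
by rewrite /fill_class cover0 setU0 => ->; rewrite mulgV.
Qed.

(** This is the quadrilateral with [p3 = A], [p2 = A :|: d] and [p1] the complement of [p2], so that
    the tiling of [e1] is empty. *)
Lemma fill_class_add A d T : balanced A -> d \notin T -> packed A (d |: T) ->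
  fill_class A (d |: T) = fill_class A [set d] * fill_class (A :|: d) T.
Proof.
move=> bA dT pT; have [dd Ad pd pAT] := packed_add dT pT.
have bAd : balanced (A :|: d) by rewrite balanced_add.
have [e2 [s2 t2 T2 f2]] := dart_exists bAd pAT.
have [e4 [s4 t4 T4 f4]] := dart_exists bA pd.
have bq : balanced (~: (A :|: cover (d |: T))) by rewrite balanced_setC balanced_cover.
have [e3 [s3 t3 T3 f3]] := dart_exists bq (packed_setC pT).
rewrite setC_cover // in t3.
have bp1 : balanced (~: (A :|: d)) by rewrite balanced_setC.
have [e1 [s1 t1 T1 f1]] := dart_exists bp1 (packed0 _).
rewrite cover0 setU0 setCK in t1; rewrite cover_set1 in t4.
have q : domino_attached [:: e1; e2; e3; e4].
  apply: (@AttachQuad D (dsource e1) (dsource e2) (dsource e4) (dtarget e2) d) => //.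
  - by rewrite s4 disjoint_sym.
  - by rewrite s2 s4.
  - by congr (_, _); apply: val_inj; rewrite t1 s2.
  - rewrite f3; congr (_, _, _); apply: val_inj; rewrite ?s3 ?t2 ?t3 ?s4 //.
    by rewrite cover_add setUA.
  - by rewrite f4; congr (_, _, _); apply: val_inj; rewrite t4 s1.
  - by rewrite T3 T2.
  - by rewrite T4 T1 setU0.
have := g_attached q; rewrite !big_cons big_nil mulg1 !floor_classE.
rewrite s1 s2 s3 s4 t1 t2 t3 t4 T1 T2 T3 T4 (floor_class_opp bA pT).
rewrite /fill_class cover_set1 cover_add !setUA !mulgA => rel.
congr (_ * _).
by rewrite -(mulg1_eq rel) !invgM invgK !mulgA !mulgVK.
Qed.

Lemma fill_class_commute A d d' : balanced A -> d != d' -> packed A [set d; d'] ->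
  fill_class A [set d] * fill_class (A :|: d) [set d'] =
  fill_class A [set d'] * fill_class (A :|: d') [set d].
Proof.
move=> bA dd' pA; have d'd : d' \notin [set d] by rewrite inE eq_sym.
have dd2 : d \notin [set d'] by rewrite inE.
have pA' : packed A (d' |: [set d]) by rewrite setUC.
by rewrite -(fill_class_add bA dd2 pA) -(fill_class_add bA d'd pA') setUC.
Qed.

(** A bigon needs distinct ends. Equal ends would force [A] to be empty and [T] to tile the whole
    disk, whose [2 * L] squares exceed 4. *)
Lemma fill_class_flip A T T' : balanced A -> packed A T -> packed A T' ->
  cover T = cover T' -> (#|cover T| <= 4)%N -> flip T T' ->
  fill_class A T = fill_class A T'.
Proof.
move=> bA pT pT' TT' cT fl; rewrite /fill_class -TT'; congr (_ * _).
have [e [s1 t1 T1 _]] := dart_exists bA pT.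
have [e' [s2 t2 T2 _]] := dart_exists bA pT'.
have ss : dsource e = dsource e' by apply: val_inj; rewrite s1 s2.
have tt : dtarget e = dtarget e' by apply: val_inj; rewrite t1 t2 TT'.
have st : dsource e <> dtarget e.
  move/(congr1 val); rewrite s1 t1 => AE.
  have A0 : A = set0.
    apply/setP=> x; rewrite inE; apply/negP => xA.
    by have := xA; rewrite {1}AE !inE xA.
  move/(congr1 (fun B : {set D} => #|B|)): AE; rewrite A0 set0U cards0 => /esym/eqP.
  have := cardsC (cover T).
  have -> : #|{: D}| = (L * 2)%N.
    rewrite (bij_eq_card (Bijective (@unsqK L) (@sqK L))).
    by rewrite card_prod card_ord card_bool.
  by move: cT L_gt2; clear; lia.
have := g_attached (AttachFlip ss tt st (_ : flip (dtiling e) (dtiling e'))).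
rewrite T1 T2 => /(_ fl); rewrite !big_cons big_nil mulg1 g_opp => /divg1_eq.
by rewrite !floor_classE s1 s2 t1 t2 T1 T2 -TT'.
Qed.

Definition move_class X s t : H :=
  if black s then fill_class (filling X) [set dom s t]
  else (fill_class (filling (mv X s t)) [set dom s t])^-1.

Lemma balanced_filling X : #|X| = L -> balanced (filling X).
Proof. by move=> XL; rewrite balanced_particles fillingK XL. Qed.

Lemma move_class_inv X s t : #|X| = L -> movable X s t ->
  move_class (mv X s t) t s = (move_class X s t)^-1.
Proof.
move=> XL /and3P[sX tX st]; rewrite /move_class (adj_black st) mvK // domC.
by case: (black s); rewrite ?invgK.
Qed.

Definition square_relation X s t s' t' :=
  move_class X s t * move_class (mv X s t) s' t' =
  move_class X s' t' * move_class (mv X s' t') s t.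

Lemma dom_neq s t s' t' : s != s' -> s != t' -> dom s t != dom s' t'.
Proof.
move=> ss' st'; apply/eqP => /setP/(_ (sq s)).
by rewrite !sq_dom eqxx (negbTE ss') (negbTE st').
Qed.

Lemma packed_two X s t s' t' : black s -> black s' -> movable X s t -> movable X s' t' ->
  s != s' -> t != t' -> dom s t != dom s' t' /\ packed (filling X) [set dom s t; dom s' t'].
Proof.
move=> bs bs' Xst Xst' ss' tt'.
have := (Xst, Xst') => -[/and3P[sX tX st] /and3P[s'X t'X s't']].
have st' : s != t' by apply: contraNneq t'X => <-.
have ts' : t != s' by apply: contraNneq tX => ->.
have ne := dom_neq t ss' st'; split=> //.
have disj : [disjoint dom s t & dom s' t'].
  rewrite disjoints_subset; apply/subsetP=> x; rewrite -(unsqK x) in_setC !sq_dom.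
  by case/orP=> /eqP->; rewrite negb_or ?ss' ?st' ?ts' ?tt'.
have dst : domino (dom s t) by apply/dominoP; exists s, t.
have dst' : domino (dom s' t') by apply/dominoP; exists s', t'.
split.
- apply/trivIsetP=> B C; rewrite !inE => /orP[]/eqP-> /orP[]/eqP->; rewrite ?eqxx // => _.
  by rewrite disjoint_sym.
- by move=> B; rewrite !inE => /orP[]/eqP->.
rewrite cover_add cover_set1 -setI_eq0 setIUr setU_eq0 !setI_eq0.
by rewrite !movable_filling.
Qed.

Lemma square_relation_black X s t s' t' : #|X| = L -> black s -> black s' ->
  movable X s t -> movable X s' t' -> s != s' -> t != t' -> square_relation X s t s' t'.
Proof.
move=> XL bs bs' Xst Xst' ss' tt'; have [ne p2] := packed_two bs bs' Xst Xst' ss' tt'.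
rewrite /square_relation /move_class bs bs' !filling_mv //.
exact: fill_class_commute (balanced_filling XL) ne p2.
Qed.

(** The same square of configurations, read from another corner. *)
Lemma square_relation_rev X s t s' t' : #|X| = L ->
  movable X s t -> movable X s' t' -> s != s' -> t != t' ->
  square_relation (mv X s' t') t' s' s t -> square_relation X s t s' t'.
Proof.
move=> XL Xst Xst' ss' tt'.
have Xst2 := movable_mv2 Xst Xst' ss' tt'.
have := (Xst, Xst') => -[/and3P[sX tX st] /and3P[s'X t'X s't']].
rewrite /square_relation mvK // move_class_inv // mvC // move_class_inv ?card_mv //.
move=> e; apply: (mulgI (move_class X s' t')^-1).
by rewrite mulgA e mulgVK mulKg.
Qed.

Lemma square_relationC X s t s' t' : square_relation X s t s' t' -> square_relation X s' t' s t.
Proof. exact: esym. Qed.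

(** At one corner of the square both moves start at black sites, that is, add dominoes; there the
    relation is [fill_class_commute]. *)
Lemma move_class_square X s t s' t' : #|X| = L ->
  movable X s t -> movable X s' t' -> s != s' -> t != t' -> square_relation X s t s' t'.
Proof.
have half (Y : {set site L}) x y x' y' : #|Y| = L -> black x -> movable Y x y -> movable Y x' y' ->
    x != x' -> y != y' -> square_relation Y x y x' y'.
  move=> YL bx Yxy Yxy' xx' yy'; have [bx'|bx'] := boolP (black x').
    exact: square_relation_black.
  have := (Yxy, Yxy') => -[/and3P[xY yY xy] /and3P[x'Y y'Y x'y']].
  have xy' : x != y' by apply: contraNneq y'Y => <-.
  have yx' : y != x' by apply: contraNneq yY => ->.
  apply: square_relation_rev => //; apply: square_relation_black; rewrite ?card_mv //.
  - by rewrite (adj_black x'y').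
  - exact: movable_mv.
  - by rewrite /movable !in_mv xY (negbTE yY) xx' orbT andbF orbF yy' xy.
  - by rewrite eq_sym.
  - by rewrite eq_sym.
move=> XL Xst Xst' ss' tt'; have [bs|bs] := boolP (black s); first exact: half.
have := (Xst, Xst') => -[/and3P[sX tX st] /and3P[s'X t'X s't']].
have s't : s' != t by apply: contraNneq tX => <-.
have t's : t' != s by apply: contraNneq t'X => ->.
apply/square_relationC/square_relation_rev; rewrite 1?eq_sym //.
apply: half; rewrite ?card_mv //.
- by rewrite (adj_black st).
- exact: movable_mv.
- by rewrite /movable !in_mv s'X (negbTE t'X) [s' == s]eq_sym ss' orbT andbF orbF eq_sym tt' s't'.
- by rewrite eq_sym.
- by rewrite eq_sym.
Qed.

Lemma flip_columns i (k : 'I_L) : i.+1 = k :> nat ->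
  flip [set vdom i; vdom k] [set hdom i k false; hdom i k true] /\
  flip [set hdom i k false; hdom i k true] [set vdom i; vdom k].
Proof.
move=> ik; split; exists (sq (i, false)), (sq (k, false)), (sq (i, true)), (sq (k, true));
  rewrite /= -ik; (split; [by congr (_, _); lia | by [] | by congr (_, _); lia | ]).
  by right; rewrite setDv set0U.
by left; rewrite setDv set0U.
Qed.

Lemma flip_square i (k : 'I_L) b : (i.+1 == k :> nat) || (k.+1 == i :> nat) ->
  let V := [set dom (i, b) (i, ~~ b); dom (k, ~~ b) (k, b)] in
  let Hs := [set dom (i, b) (k, b); dom (k, ~~ b) (i, ~~ b)] in
  flip V Hs /\ flip Hs V.
Proof.
move=> ik V Hs.
have -> : V = [set vdom i; vdom k].
  by rewrite /V /vdom; case: (b) => /=; congr [set _; _]; exact: domC.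
have -> : Hs = [set hdom i k false; hdom i k true].
  rewrite /Hs /hdom; case: (b) => /=; first rewrite setUC; congr [set _; _]; exact: domC.
case/orP: ik => /eqP ik; first exact: flip_columns ik.
rewrite /hdom (domC (i, false)) (domC (i, true)) setUC; exact: flip_columns ik.
Qed.

Lemma flip_cycle s s' t t' : adj s t -> adj s t' -> adj s' t -> adj s' t' ->
  s != s' -> t != t' -> flip [set dom s t; dom s' t'] [set dom s t'; dom s' t].
Proof.
case: s s' t t' => [i b] [i' b'] [k c] [k' c'].
rewrite /adj -!val_eqE !xpair_eqE -!val_eqE /= => a1 a2 a3 a4 n1 n2.
(* A 4-cycle of the ladder is a unit square; the cases tell which of [t] and [t'] lies in the column
   of [s]. *)
have : [&& k == i :> nat, c == ~~ b, c' == b, i' == k' :> nat, b' == ~~ b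
      & (i.+1 == k' :> nat) || (k'.+1 == i :> nat)] ||
    [&& k' == i :> nat, c' == ~~ b, c == b, i' == k :> nat, b' == ~~ b
      & (i.+1 == k :> nat) || (k.+1 == i :> nat)].
  by move: a1 a2 a3 a4 n1 n2; case: b b' c c' => -[] [] [] /=; clear; lia.
move=> {a1 a2 a3 a4 n1 n2}.
case/orP=> /and5P[/eqP/val_inj-> /eqP-> /eqP-> /eqP/val_inj-> /andP[/eqP-> ik]].
  by have [] := flip_square b ik.
by have [] := flip_square b ik.
Qed.

Lemma move_class_flip_black X s s' t t' : #|X| = L -> black s -> black s' ->
  movable X s t -> movable X s t' -> movable X s' t -> movable X s' t' ->
  s != s' -> t != t' ->
  move_class X s t * move_class (mv X s t) s' t' =
  move_class X s t' * move_class (mv X s t') s' t.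
Proof.
move=> XL bs bs' st st' s't s't' ss' tt'.
have t't : t' != t by rewrite eq_sym.
have [ne p] := packed_two bs bs' st s't' ss' tt'.
have [ne' p'] := packed_two bs bs' st' s't ss' t't.
have bX := balanced_filling XL.
rewrite /move_class bs bs' !filling_mv // -!fill_class_add ?inE //.
have cE x y x' y' : cover [set dom x y; dom x' y'] = dom x y :|: dom x' y'.
  by rewrite cover_add cover_set1.
apply: fill_class_flip => //.
- rewrite !cE; apply/setP=> x; rewrite !inE.
  by do 4![case: (x == _)].
- rewrite cE; apply: leq_trans (leq_card_setU _ _) _.
  by rewrite !cards2; do 2![case: (_ != _)].
- have adjm x y : movable X x y -> adj x y by case/and3P.
  by apply: flip_cycle => //; apply: adjm.
Qed.

Lemma move_class_flat : flat move_class.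
Proof.
split=> [X s t XL|X s t s' t' XL|X s s' t t' XL st st' s't s't' ss' tt'].
- exact: move_class_inv.
- exact: move_class_square.
have [[/and3P[sX tX a1] /and3P[_ t'X a2]] [/and3P[s'X _ a3] /and3P[_ _ a4]]] :=
  ((st, st'), (s't, s't')).
have [bs|bs] := boolP (black s).
  apply: move_class_flip_black => //.
  by rewrite -[black s']negbK -(adj_black a3) (adj_black a1) bs.
have bt : black t by rewrite (adj_black a1) bs.
have bt' : black t' by rewrite (adj_black a2) bs.
have t't : t' != t by rewrite eq_sym.
have s's : s' != s by rewrite eq_sym.
have ts : t != s by rewrite eq_sym adj_neq.
have ts' : t != s' by rewrite eq_sym adj_neq.
have t's : t' != s by rewrite eq_sym adj_neq.
have t's' : t' != s' by rewrite eq_sym adj_neq.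
(* From white sites the rotation is run backwards from its final configuration, where the moves
   start at black sites. *)
have rev2 x y x' y' : movable X x y -> movable (mv X x y) x' y' ->
    let Z := mv (mv X x y) x' y' in
    move_class Z y' x' * move_class (mv Z y' x') y x =
    (move_class X x y * move_class (mv X x y) x' y')^-1.
  move=> xy xy' Z; have := (xy, xy') => -[/and3P[xX yX _] /and3P[x'X y'X _]].
  by rewrite /Z mvK // move_class_inv ?card_mv // move_class_inv // invgM.
have m1 : movable (mv X s t) s' t' by apply: movable_mv2; rewrite // eq_sym.
have m2 : movable (mv X s' t) s t' by apply: movable_mv2; rewrite // eq_sym.
pose Z := mv (mv X s t) s' t'.
have ZE : mv (mv X s' t) s t' = Z by rewrite /Z mv_swap // mvC.
have tZ : t \in Z by rewrite !in_mv eqxx ts' orbT.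
have t'Z : t' \in Z by rewrite !in_mv eqxx.
have sZ : s \notin Z by rewrite !in_mv eqxx !(eq_sym s) (negbTE ts) (negbTE t's) andbF.
have s'Z : s' \notin Z by rewrite !in_mv eqxx (eq_sym s') (negbTE t's').
have ZL : #|Z| = L by case/and3P: m1 => ? ? _; rewrite !card_mv.
have := @move_class_flip_black Z t' t s' s ZL bt' bt.
rewrite /movable tZ t'Z sZ s'Z !(adjC t) !(adjC t') a1 a2 a3 a4 => /(_ isT isT isT isT t't s's).
rewrite (rev2 _ _ _ _ st m1) -/Z -{1}ZE -{1}ZE (rev2 _ _ _ _ s't m2) => /invg_inj ->.
by apply: move_class_square; rewrite // eq_sym.
Qed.

Variables (h : {set site L} -> H) (A0 : int -> H).
Hypothesis A0C : forall m n, RL L m n -> commute (A0 m) (A0 n).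
Hypothesis move_classE : forall X s t, #|X| = L -> movable X s t ->
  move_class X s t = h X * step_value A0 X s t * (h (mv X s t))^-1.

Lemma floor_value_step A s t : adj s t -> black s ->
  floor_value A0 false A [set dom s t] = step_value A0 (particles A) s t.
Proof.
move=> st bs; rewrite /step_value; have [st1|st1] := eqVneq s.1 t.1; last first.
  apply: floor_value_horizontal => j; apply: contraNneq st1 => e.
  have := sq_vdom j s; have := sq_vdom j t.
  by rewrite -e !sq_dom !eqxx orbT /= => /esym/eqP-> /esym/eqP->.
case: s t st1 st bs => [j b] [j' b'] /= <-; rewrite /black /adj /= !eqxx gtn_eqF //= andbF orbF.
move=> bb' bs; have -> : b' = ~~ b by case: b b' bb' {bs} => -[].
have -> : dom (j, b) (j, ~~ b) = vdom j by case: (b); rewrite // domC.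
rewrite floor_value1 /vdom_value addbF /=.
by move: bs; rewrite oddD; case: (odd j); case: (b).
Qed.

Lemma fill_classE A T : balanced A -> packed A T ->
  fill_class A T = h (particles A) * floor_value A0 false A T * (h (particles (A :|: cover T)))^-1.
Proof.
move=> bA pT; move: A T pT bA; apply: packed_ind => [A|A d T dT pT IH] bA.
  by rewrite fill_class0 // floor_value0 mulg1 cover0 setU0 mulgV.
have [dd Ad pd pAT] := packed_add dT pT.
rewrite fill_class_add // IH ?balanced_add // floor_value_add // cover_add setUA.
have -> : fill_class A [set d] =
    h (particles A) * floor_value A0 false A [set d] * (h (particles (A :|: d)))^-1.
  case/domino_blackP: dd Ad => s [t [st bs ->]] Ad.
  have [Ast mvE] := add_domino st bs Ad.
  rewrite floor_value_step // mvE -move_classE //; last first.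
    by apply/eqP; rewrite -balanced_particles.
  by rewrite /move_class bs particlesK.
by rewrite !mulgA mulgVK.
Qed.

(* The gauge transformation that makes [g] equal to the floor values; at odd
   height plugs are compared with the complementary plug at even height. *)
Definition potential b A : H :=
  if b then floor_class A (~: A) set0 * h (particles (~: A)) else h (particles A).

(** From even height an edge is a filling followed by an empty floor backwards, which [potential]
    absorbs. From odd height it is the reverse of such an edge. *)
Lemma edge_holonomy b e :
  g e = potential b (val (dsource e)) * floor_value A0 b (val (dsource e)) (dtiling e)
    * (potential (~~ b) (val (dtarget e)))^-1.
Proof.
have even e' : g e' = potential false (val (dsource e')) *
    floor_value A0 false (val (dsource e')) (dtiling e') * (potential true (val (dtarget e')))^-1.
  have pT := dart_packed e'; have tE := dart_target e'.
  have tC : ~: val (dtarget e') = val (dsource e') :|: cover (dtiling e').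
    by rewrite tE setCK.
  rewrite /potential tC invgM mulgA -fill_classE //; last exact: valP (dsource e').
  by rewrite /fill_class -tE -tC mulgK -floor_classE.
case: b; last exact: even.
rewrite -[g e]invgK -g_opp even dsource_dopp dtarget_dopp dtiling_dopp.
rewrite (floor_value_target A0C false e) !invgM !invgK mulgA.
by [].
Qed.

Lemma walk_holonomy b (w : seq (domino_dart D)) (x y : plug D) : walk (K := domino_graph D) x w y ->
  \prod_(e <- w) g e =
  potential b (val x) * holonomy A0 b w * (potential (odd (size w) (+) b) (val y))^-1.
Proof.
elim: w b x => [|e w IHw] b x /=; first by move=> /eqP->; rewrite big_nil mulg1 mulgV.
case/andP=> /eqP <- ww; rewrite big_cons (IHw (~~ b) _ ww) (edge_holonomy b e).
by rewrite !mulgA mulgVK addNb addbN.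
Qed.

End Transport.

Theorem holonomy_classification L (H : groupType) (g : domino_dart (rectangle2 L) -> H) :
  (2 < L)%N -> (forall e, g (dopp e) = (g e)^-1) ->
  (forall s, domino_attached s -> \prod_(e <- s) g e = 1) ->
  exists (A : int -> H) (k : H),
    [/\ A 0%R = 1, forall m n, RL L m n -> commute (A m) (A n)
      & forall s, walk (K := domino_graph (rectangle2 L)) (empty_plug _) s (empty_plug _) ->
          ~~ odd (size s) -> \prod_(e <- s) g e = k * holonomy A false s * k^-1].
Proof.
move=> L2 go ga; have [h [A [A0 AC hA]]] := flat_classification (move_class_flat L2 go ga).
exists A, (potential g h false (val (empty_plug (rectangle2 L)))); split=> // s ws even.
by rewrite (walk_holonomy go ga AC hA false ws) (negbTE even).
Qed.

(** * Walks with prescribed holonomy *)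

Section Reachability.
Variables (L : nat) (H : groupType) (A : int -> H).
Hypothesis A0 : A 0%R = 1.
Hypothesis AC : forall m n, RL L m n -> commute (A m) (A n).
Local Notation D := (rectangle2 L).
Implicit Types (s t : site L) (X : {set site L}) (p q : plug D) (w : seq (domino_dart D)).

Definition even_walk p w q (x : H) :=
  [/\ walk (K := domino_graph D) p w q, ~~ odd (size w) & holonomy A false w = x].

Lemma even_walk_cat p q r w w' x x' :
  even_walk p w q x -> even_walk q w' r x' -> even_walk p (w ++ w') r (x * x').
Proof.
case=> pq ew wx [qr ew' wx']; split; first exact: (@walk_cat (domino_complex D) _ _ _ _ _ pq qr).
  by rewrite size_cat oddD (negbTE ew).
by rewrite holonomy_cat (negbTE ew) wx wx'.
Qed.

Lemma even_walk_inv p q w x : even_walk p w q x -> even_walk q (winv (@dopp D) w) p x^-1.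
Proof.
case=> pq ew wx; split; first exact: (@walk_winv (domino_complex D) _ _ _ pq).
  by rewrite size_rev size_map.
by have := holonomy_winv AC false w; rewrite (negbTE ew) wx.
Qed.

(** The walk adds the domino on the way to the complement of [q] and then reaches [q] through an
    empty floor. *)
Lemma even_walk_move X s t p q : black s -> #|X| = L -> movable X s t ->
  val p = filling X -> val q = filling (mv X s t) ->
  exists w, even_walk p w q (step_value A X s t).
Proof.
move=> bs XL st pE qE; have dX := movable_filling bs st.
have a : adj s t by case/and3P: st.
have dd : domino (dom s t) by apply/dominoP; exists s, t.
have bX : balanced (filling X) by rewrite balanced_particles fillingK XL.
have qE' : val q = filling X :|: dom s t by rewrite qE filling_mv.
have [e [se te Te _]] := dart_exists bX (packed1 dd dX).
have bC : balanced (~: val q) by rewrite balanced_setC (valP q).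
have [e' [se' te' Te' _]] := dart_exists bC (packed0 _).
rewrite cover_set1 in te; rewrite cover0 setU0 setCK in te'.
exists [:: e; e']; split=> //=.
  apply/and3P; split; apply/eqP/val_inj; rewrite ?se ?te ?se' ?te' ?pE ?qE' //.
by rewrite Te' floor_value0 !mulg1 se Te floor_value_step // fillingK.
Qed.

(** The only vertical step of the path is in the last column, where [flux_movable_bound] forces the
    flux to be 0. *)
Lemma step_path X s t : #|X| = L -> movable X s t ->
  pos s = (pos t).+1 \/ pos t = (pos s).+1 -> step_value A X s t = 1.
Proof.
move=> XL st pst; rewrite /step_value; case: eqP => // st1.
suff -> : flux X s.1 = 0%R by rewrite A0 invg1; case: (s.2).
case: s t st1 pst st => [j b] [_ b'] /= <- pst st.
have bb' : b' = ~~ b.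
  case/and3P: st => _ _; rewrite /adj /= !eqxx gtn_eqF //= andbF orbF.
  by case: b b' {pst} => -[].
rewrite bb' in pst st; have [_] := flux_movable_bound XL st.
by move: pst; rewrite /pos /=; have := ltn_ord j; case: (b) => /=; lia.
Qed.

Lemma pos_pred (c : site L) : (0 < pos c)%N -> exists c' : site L, pos c = (pos c').+1.
Proof.
case: c => i [] p0.
  have [iL|iL] := ltnP i.+1 L.
    by exists (Ordinal iL, true); rewrite /pos /=; lia.
  by exists (i, false); rewrite /pos /=; have := ltn_ord i; lia.
have iL : (i.-1 < L)%N by have := ltn_ord i; lia.
by exists (Ordinal iL, false); move: p0; rewrite /pos /=; lia.
Qed.

(** Moves along the path connect all configurations. Having value 1, they bring a generator back to
    the base point without conjugating it. *)
Lemma reachable p : exists w, even_walk (empty_plug D) w p 1.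
Proof.
pose Q X := forall q, val q = filling X -> exists w, even_walk (empty_plug D) w q 1.
have Q0 : Q (particles set0).
  move=> q; rewrite particlesK => q0; exists [::]; split=> //=.
  by apply/eqP/val_inj.
have plugL X q : val q = filling X -> #|X| = L.
  by move=> qX; apply/eqP; rewrite -[X]fillingK -balanced_particles -qX; apply: valP q.
suff QX X : #|X| = L -> Q X.
  apply: (QX (particles (val p))); last by rewrite particlesK.
  by apply/eqP; rewrite -balanced_particles; apply: valP p.
move=> XL; apply: (@config_connected L setT (@pos L) Q _ _ _ (particles set0) X) => //.
- by move=> s t _ _; apply: pos_inj.
- by move=> c _ /pos_pred[c' ->]; exists c'.
- move=> {XL}X s t _ _ sX tX pst QX q qE.
  have XL : #|X| = L by apply: etrans (plugL _ _ qE); rewrite card_mv.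
  have a : adj s t by case: pst => /pos_adj; rewrite // adjC.
  have st : movable X s t by rewrite /movable sX tX.
  have bX : balanced (filling X) by rewrite balanced_particles fillingK XL.
  pose p0 : plug D := exist (fun A => balanced A) _ bX.
  have [w0 W0] := QX p0 erefl.
  have [bs|bs] := boolP (black s).
    have [w W] := even_walk_move bs XL st (p := p0) (q := q) erefl qE.
    exists (w0 ++ w); rewrite -[1]mulg1 -{2}(step_path XL st pst).
    exact: even_walk_cat W0 W.
  have bt : black t by rewrite (adj_black a).
  have pst' : pos t = (pos s).+1 \/ pos s = (pos t).+1 by case: pst; [right | left].
  have ts := movable_mv st.
  have mL : #|mv X s t| = L by rewrite card_mv.
  have [|w W] := even_walk_move bt mL ts (p := q) (q := p0) qE.
    by rewrite mvK.
  exists (w0 ++ winv (@dopp D) w); rewrite -[1]mulg1 -{2}invg1 -{2}(step_path mL ts pst').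
  exact: even_walk_cat W0 (even_walk_inv W).
- by rewrite !setDT.
- rewrite !setIT XL; apply/eqP; rewrite -balanced_particles; exact: balanced0.
Qed.

Lemma generator_walk (k : int) : (`|k|.*2 < L)%N ->
  exists w, even_walk (empty_plug D) w (empty_plug D) (A k).
Proof.
move=> kL; have [X [XL XP]] := config_one kL.
have jL : (`|k| < L)%N by lia.
have [fX st] : flux X (Ordinal jL) = k /\
    movable X (Ordinal jL, false) (Ordinal jL, true).
  by apply: XP => //=; lia.
set s := (Ordinal jL, false) in st; set t := (Ordinal jL, true) in st.
have := st => /and3P[sX tX a].
have mL : #|mv X s t| = L by rewrite card_mv.
have bal (Y : {set site L}) : #|Y| = L -> balanced (filling Y).
  by move=> YL; rewrite balanced_particles fillingK YL.
pose p : plug D := exist (fun A => balanced A) _ (bal X XL).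
pose q : plug D := exist (fun A => balanced A) _ (bal _ mL).
have [w0 W0] := reachable p; have [w1 W1] := reachable q.
suff [w W] : exists w, even_walk p w q (A k).
  exists (w0 ++ w ++ winv (@dopp D) w1); rewrite -[A k]mulg1 -[A k * 1]mul1g -{2}invg1.
  by apply: even_walk_cat W0 (even_walk_cat W (even_walk_inv W1)).
have [bs|bs] := boolP (black s).
  have [w W] := even_walk_move bs XL st (p := p) (q := q) erefl erefl.
  by exists w; move: W; rewrite /step_value /= eqxx fX.
have bt : black t by rewrite (adj_black a).
have [|w W] := even_walk_move bt mL (movable_mv st) (p := q) (q := p) erefl.
  by rewrite mvK.
exists (winv (@dopp D) w); rewrite -[A k]invgK; apply: even_walk_inv.
by move: W; rewrite /step_value /= eqxx (flux_mv_vertical (b := false)) // fX.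
Qed.

End Reachability.

(** * The isomorphism *)

Section WordClass.
Variables (S : choiceType) (R : seq (S * bool) -> Prop).
Implicit Types u v w : seq (S * bool).

Definition word_class w : presented_group R := qclass (P := words_pregroup R) w.

Lemma word_class_cat u v : word_class (u ++ v) = word_class u * word_class v.
Proof. exact: (@qclassM (words_pregroup R)). Qed.

Lemma word_class_weq u v : weq R u v -> word_class u = word_class v.
Proof. by move=> uv; apply/(qclassP (P := words_pregroup R)). Qed.

Lemma word_class_nil : word_class [::] = 1.
Proof. by []. Qed.

Lemma word_class_winv w : word_class (winv (@letter_inv S) w) = (word_class w)^-1.
Proof. by apply/esym/mulg1_eq; rewrite -word_class_cat; apply/word_class_weq/weq_mulgV. Qed.

Lemma word_class_relator r : R r -> word_class r = 1.
Proof.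
move=> Rr; apply/esym/word_class_weq/rst_step.
by rewrite -[r]cats0; apply: (ExpandRel _ [::] [::]).
Qed.

Lemma word_class_surj (x : presented_group R) : exists w, x = word_class w.
Proof. by exists (qrepr x); rewrite /word_class (@qreprK (words_pregroup R)). Qed.

End WordClass.

Section PresentedGroup.
Variables (S : choiceType) (R : seq (S * bool) -> Prop) (H : groupType) (f : S -> H).

Definition word_value (w : seq (S * bool)) : H := \prod_(a <- w) signed a.2 (f a.1).

Hypothesis f_relator : forall r, R r -> word_value r = 1.

Lemma word_value_cat u v : word_value (u ++ v) = word_value u * word_value v.
Proof. exact: big_cat. Qed.

Lemma word_value_winv w : word_value (winv (@letter_inv S) w) = (word_value w)^-1.
Proof.
elim: w => [|a w IHw]; first by rewrite /word_value !big_nil invg1.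
rewrite /winv /= rev_cons -cats1 word_value_cat -/(winv _ _) IHw.
rewrite /word_value big_cons big_nil big_cons invgM mulg1.
by case: a => s [] /=; rewrite ?invgK.
Qed.

Lemma word_value_weq u v : weq R u v -> word_value u = word_value v.
Proof.
apply: eqclos_inv => {u v} x y [u v a|u v r /f_relator r1]; rewrite !word_value_cat.
  have -> : word_value [:: a; letter_inv a] = 1.
    rewrite -cat1s word_value_cat -[[:: letter_inv a]]/(winv (@letter_inv S) [:: a]).
    by rewrite word_value_winv mulgV.
  by rewrite mul1g.
by rewrite r1 mul1g.
Qed.

Definition presented_value (x : presented_group R) : H := word_value (qrepr x).

Lemma presented_value_class w : presented_value (word_class R w) = word_value w.
Proof. exact: word_value_weq (@qreprP (words_pregroup R) w). Qed.

Lemma presented_valueM : {morph presented_value : x y / x * y}.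
Proof.
move=> x y; have [u ->] := word_class_surj x; have [v ->] := word_class_surj y.
by rewrite -word_class_cat !presented_value_class word_value_cat.
Qed.

End PresentedGroup.

Section HolonomyMorphism.
Variables (L : nat) (G H : groupType) (f : G -> H).
Hypothesis fM : {morph f : x y / x * y}.
Local Notation D := (rectangle2 L).

(** Only fluxes [k] with [2 * |k| < L] occur at vertical dominoes, so agreement on the indices of
    actual generators suffices. *)
Lemma morph_holonomy (A : int -> G) (B : int -> H) b (w : seq (domino_dart D)) :
  (forall k : int, (`|k|.*2 < L)%N -> f (A k) = B k) ->
  f (holonomy A b w) = holonomy B b w.
Proof.
move=> AB; have f1 : f 1 = 1 by apply: (mulIg (f 1)); rewrite -fM !mul1g.
have fV x : f x^-1 = (f x)^-1 by apply/esym/mulg1_eq; rewrite -fM mulgV f1.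
elim: w b => [|e w IHw] b //=; rewrite fM IHw; congr (_ * _).
rewrite /floor_value (big_morph f fM f1); apply: eq_bigr => j jT.
have pT := dart_packed e; have := valP (dsource e); rewrite /= balanced_particles => /eqP XL.
have dj : [disjoint val (dsource e) & vdom j].
  by case: pT => _ _; apply: disjointWr; apply: (bigcup_sup (vdom j)).
have := disjoint_vdom_movable dj; rewrite -[X in movable _ _ (_, X)]negbK.
move=> /(flux_movable_bound XL)[kj kL].
rewrite /vdom_value -AB; last by case: (b) => /=; move: kj kL; clear; lia.
by rewrite /signed; case: (odd j (+) b).
Qed.

End HolonomyMorphism.

Section Main.
Variable L : nat.
Local Notation D := (rectangle2 L).

Definition generator_class (m : int) : GLplus L := word_class (@GLplus_relator L) (gen L m).

Lemma gen0 : gen L 0 = [::].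
Proof. by rewrite /gen insubF. Qed.

Lemma gen_val (s : symbolS L) : gen L (val s) = [:: (s, true)].
Proof. by rewrite /gen valK. Qed.

Lemma generator_class0 : generator_class 0 = 1.
Proof. by rewrite /generator_class gen0. Qed.

Lemma generator_class_commute m n : RL L m n ->
  commute (generator_class m) (generator_class n).
Proof.
move=> mn; have := @word_class_relator _ (@GLplus_relator L) (wcomm (gen L m) (gen L n)).
rewrite /wcomm !word_class_cat !word_class_winv => e.
have {e} : (generator_class n * generator_class m)^-1 *
    (generator_class m * generator_class n) = 1.
  by rewrite invgM -mulgA; apply: e; exists m, n.
by move/mulg1_eq; rewrite invgK.
Qed.

Let base_group := walk_pregroup (K := domino_complex D) (empty_plug D).

Definition loop_holonomy (p : base_group) : GLplus L := holonomy generator_class false (val p).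

Lemma loop_holonomy_repr (p : base_group) :
  loop_holonomy (qrepr (qclass p)) = loop_holonomy p.
Proof.
apply: (holonomy_homotopic generator_class_commute false).
exact: (@qreprP base_group).
Qed.

Definition even_holonomy (x : even_domino_group D) : GLplus L :=
  loop_holonomy (qrepr (val x : domino_group D)).

Lemma even_repr (x : even_domino_group D) : ~~ odd (size (val (qrepr (val x : domino_group D)))).
Proof.
have /eqP := valP x; rewrite /parity /walk_parity.
by move/(congr1 val); rewrite /= val_Zp_nat // modn2; case: odd.
Qed.

Lemma even_holonomyM : {morph even_holonomy : x y / x * y}.
Proof.
move=> x y; rewrite /even_holonomy.
have -> : (val (x * y) : domino_group D) =
    qclass (walk_mul (qrepr (val x : domino_group D))
                     (qrepr (val y : domino_group D)) : base_group).
  by [].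
rewrite loop_holonomy_repr /loop_holonomy /= holonomy_cat.
(* The first walk has even length, so the second one starts at even height again. *)
by rewrite (negbTE (even_repr x)).
Qed.

HB.instance Definition _ :=
  isMultiplicative.Build (even_domino_group D) (GLplus L) even_holonomy even_holonomyM.

(** The classification of the labelling [edge_class] yields elements [A] of the domino group, and
    [f] sends the generators to them; [f] after [even_holonomy] is then the inclusion up to
    conjugation. *)
Lemma even_holonomy_inj : (2 < L)%N -> injective even_holonomy.
Proof.
move=> L2 x y xy.
have /choice[c cP] : forall p : plug D, exists w, even_walk generator_class (empty_plug D) w p 1.
  exact: reachable generator_class0 generator_class_commute.
have cw p : walk (K := domino_graph D) (empty_plug D) (c p) p by have [] := cP p.
pose g : domino_dart D -> domino_group D := @edge_class (domino_complex D) (empty_plug D) c cw.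
have [A [k [A0 AC AP]]] := @holonomy_classification L (domino_group D) g L2
  (@edge_class_opp (domino_complex D) (empty_plug D) c cw)
  (@edge_class_attached (domino_complex D) (empty_plug D) c cw).
have [a aP] := @edge_class_closed (domino_complex D) (empty_plug D) c cw.
pose f := presented_value (R := @GLplus_relator L) (fun s : symbolS L => A (val s)).
have gen_value m : word_value (fun s : symbolS L => A (val s)) (gen L m) =
    if (m != 0%R) && (`|m| <= L.-1./2)%N then A m else 1.
  rewrite /gen; case: insubP => [s -> <-|/negbTE->]; last by rewrite /word_value big_nil.
  by rewrite /word_value big_cons big_nil mulg1.
have relP r : GLplus_relator r -> word_value (fun s : symbolS L => A (val s)) r = 1.
  case=> m [n [mn ->]]; rewrite /wcomm !word_value_cat !word_value_winv !gen_value.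
  set x1 := (if _ then A m else _); set y1 := (if _ then A n else _).
  have xy1 : commute x1 y1.
    by rewrite /x1 /y1; case: ifP => _; case: ifP => _ //; [apply: AC | apply: commute1
      | apply/commute_sym/commute1].
  by rewrite xy1 mulgA -invgM mulVg.
have fM : {morph f : u v / u * v} by apply: presented_valueM.
have fA (m : int) : (`|m|.*2 < L)%N -> f (generator_class m) = A m.
  move=> mL; rewrite /f presented_value_class // gen_value.
  by case: eqVneq => [->|_] /=; rewrite ?A0 // ifT //; lia.
have key (z : even_domino_group D) :
    a * (val z : domino_group D) * a^-1 = k * f (even_holonomy z) * k^-1.
  rewrite /even_holonomy /loop_holonomy (morph_holonomy fM _ _ fA) -AP ?even_repr //.
    by rewrite aP (@qreprK base_group).
  exact: valP (qrepr (val z : domino_group D)).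
apply: val_inj; have := key x; rewrite xy -key.
by move/mulIg/mulgI.
Qed.

Lemma even_holonomy_surj (z : GLplus L) : (2 < L)%N -> exists x, even_holonomy x = z.
Proof.
move=> L2; have [w ->] := word_class_surj z.
suff [s [sw se sh]] : exists s, even_walk generator_class (empty_plug D) s (empty_plug D)
    (word_class (@GLplus_relator L) w).
  pose p : base_group :=
    exist (fun s => walk (K := domino_graph D) (empty_plug D) s (empty_plug D)) s sw.
  have pP : parity_ker (qclass p : domino_group D).
    rewrite /parity_ker parity_qclass /walk_parity /=; apply/eqP/val_inj.
    by rewrite /= val_Zp_nat // modn2 (negbTE se).
  exists (exist _ (qclass p) pP); rewrite /even_holonomy /=.
  by rewrite loop_holonomy_repr.
elim: w => [|[k b] w [s IH]]; first by exists [::]; split; rewrite /= ?eqxx ?word_class_nil.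
rewrite -cat1s word_class_cat.
have kL : (`|val k|.*2 < L)%N by have /andP[_] := valP k; lia.
have [t T] := generator_walk generator_class0 generator_class_commute kL.
rewrite /generator_class gen_val in T.
case: b; first by exists (t ++ s); apply: even_walk_cat T IH.
rewrite -[[:: (k, false)]]/(winv (@letter_inv _) [:: (k, true)]) word_class_winv.
exists (winv (@dopp D) t ++ s); apply: even_walk_cat (even_walk_inv _ T) IH.
exact: generator_class_commute.
Qed.

End Main.

Theorem theorem2 (L : nat) (hL : (3 <= L)%N) :
  isomorphic (even_domino_group (rectangle2 L)) (GLplus L).
Proof.
exists (even_holonomy (L := L)).
have /choice[h hK] := fun z : GLplus L => even_holonomy_surj z hL.
by exists h => // x; apply: (even_holonomy_inj hL); rewrite hK.
Qed.
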